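(* Let $m\ge 8$ and $M(h)=h^m$. Then there is a constant $c>0$ depending only on $m$ such that for every $T>0$ and every path $[0,T]\ni t\mapsto h_t$ of positive film heights on $\mathbb R$ starting from $h_0\equiv1$, the rate functional $I_T$ satisfies $$T^{\frac14}I_T(h)\ \ge\ c\cdot \begin{cases} \displaystyle\sup_{x\in\mathbb R}\Big(\ln\frac1{h_T(x)}-1+h_T(x)\Big)_+ & \text{if } m=8,\\[2ex] \displaystyle\sup_{x\in\mathbb R}\Big(\frac{1}{h_T(x)^{\frac m8-1}}-1\Big)_+^2 & \text{if } m>8, \end{cases}$$ and hence the rate functional diverges, in this quantitative sense, as $\inf_{x\in\mathbb R}h_T(x)\to0$.
   Context: Everything is posed on the whole line $\mathbb R$. A path of film heights is a family of functions $h_t:\mathbb R\to(0,\infty)$, $t\in[0,T]$, sufficiently smooth in $(t,x)$ that the expressions below make sense. Here $(a)_+=\max\{a,0\}$ and $(a)_+^2=((a)_+)^2$. For a positive function $h$ and a tangent vector $\dot h:\mathbb R\to\mathbb R$, the metric tensor is $$g_h(\dot h,\dot h)=\inf_j\Big\{\int_{\mathbb R}\frac{j^2}{M(h)}\,dx:\ \partial_xj+\dot h=0\Big\}.$$ The energy is the Dirichlet energy $E(h)=\frac12\int_{\mathbb R}(\partial_xh)^2dx$, and its gradient with respect to $g$ is $\nabla E(h)=\partial_x(M(h)\partial_x^3h)$, so that $g_h(\nabla E(h),\nabla E(h))=\int_{\mathbb R}M(h)(\partial_x^3h)^2dx$. The rate functional of the path is $$I_T(h)=\frac12\int_0^Tg_{h_t}\big(\partial_th_t+\nabla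 E(h_t),\,\partial_th_t+\nabla E(h_t)\big)\,dt$$ $$\phantom{I_T(h)}=\frac12\int_0^Tg_{h_t}(\partial_th_t,\partial_th_t)\,dt+\frac12\int_0^Tg_{h_t}(\nabla E(h_t),\nabla E(h_t))\,dt+E(h_T)-E(h_0),$$ where, as in the paper, the two expressions are taken to be equal along the paths considered. *)

(* Defs.v *)
From HB Require Import structures.
From mathcomp Require Import all_boot all_order all_algebra.
From mathcomp Require Import all_classical all_reals all_analysis.
Set Implicit Arguments.
Unset Strict Implicit.
Unset Printing Implicit Defensive.
Import Order.TTheory GRing.Theory Num.Theory.
Import numFieldNormedType.Exports.
Local Open Scope classical_set_scope.
Local Open Scope ring_scope.

Section ThinFilm.
Context {R : realType}.
Implicit Types (M : R -> R) (h : R -> R).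

Definition mobility (m : R) : R -> R := fun s => s `^ m.

Definition positive_part (a : R) : R := Num.max a 0.

(* The value is +oo when no admissible flux has finite action. *)
Definition metric_tensor M h (hdot : R -> R) : \bar R :=
  ereal_inf [set (\int[lebesgue_measure]_x ((j x) ^+ 2 / M (h x))%:E)%E |
    j in [set j : R -> R |
      forall x, derivable j x 1 /\ derive1 j x + hdot x = 0]].

Definition dirichlet_energy h : \bar R :=
  ((2^-1)%:E * \int[lebesgue_measure]_x ((derive1 h x) ^+ 2)%:E)%E.

Definition energy_gradient M h : R -> R :=
  derive1 (fun x => M (h x) * derive1n 3 h x).

(* Paths are written [h t x]; only the values for 0 <= t <= T matter. *)
Definition time_derivative (h : R -> R -> R) (t x : R) : R :=
  derive1 (fun s => h s x) t.

(* Time integrals run over the open interval, where the two-sided time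
   derivative depends only on the path; the endpoints are negligible. *)
Definition rate_functional M (h : R -> R -> R) (T : R) : \bar R :=
  ((2^-1)%:E * \int[lebesgue_measure]_(t in `]0%R, T[)
     metric_tensor M (h t)
       (fun x => time_derivative h t x + energy_gradient M (h t) x)%R)%E.

Definition rate_functional_expanded M (h : R -> R -> R) (T : R) : \bar R :=
  ((2^-1)%:E * \int[lebesgue_measure]_(t in `]0%R, T[)
     metric_tensor M (h t) (time_derivative h t)
   + (2^-1)%:E * \int[lebesgue_measure]_(t in `]0%R, T[)
     metric_tensor M (h t) (energy_gradient M (h t))
   + (dirichlet_energy (h T) - dirichlet_energy (h 0%R)))%E.

(* Smoothness is C^1 in time and C^4 in space, which is what the expressions
   above require; nothing is imposed at spatial infinity.  The equality of the
   two forms of the rate functional (the chain rule for the energy) is asked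
   along the path, i.e. for its restriction to every [0, t]. *)
Record film_path M (T : R) (h : R -> R -> R) : Prop := FilmPath {
  film_pos : forall t x, 0 <= t <= T -> 0 < h t x ;
  film_derivable_space : forall k t x, (k < 4)%N -> 0 <= t <= T ->
    derivable (derive1n k (h t)) x 1 ;
  film_continuous_space : forall k, (k <= 4)%N ->
    {within `[0, T] `*` [set: R],
      continuous (fun p : R * R => derive1n k (h p.1) p.2)} ;
  film_derivable_time : forall t x, 0 < t < T ->
    derivable (fun s => h s x) t 1 ;
  film_continuous_time :
    {within `]0, T[ `*` [set: R],
      continuous (fun p : R * R => time_derivative h p.1 p.2)} ;
  film_rate_functionalE : forall t, 0 < t <= T ->
    rate_functional M h t = rate_functional_expanded M h t }.

End ThinFilm.

(* Main.v *)
(** Write [E] for the Dirichlet energy and [I] for the rate functional at time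
    [T].  Since [E (h 0) = 0], the expanded form of the rate functional on [0, t]
    gives [E (h t) <= I] for all [t], and the action of the path is at most [2 I].
    Let [f >= 0] vanish at 1 and satisfy [f'' ~ 1 / sqrt M] near 0, so that
    [f ~ s^(2 - m/2)] there.  For a flux [j] of the path,
      [d/dt \int f(h) = \int f''(h) h_x j
         <= (\int j^2 / M)^(1/2) (\int M f''(h)^2 h_x^2)^(1/2)],
    and the last factor is at most a multiple of [sqrt (E h)], whence
    [\int f(h_T) <= c I sqrt T].
    If [|psi'| <= c sqrt f] and [psi 1 = 0], interpolating this with the energy yields
      [psi (h_T x) <= \int |psi'(h_T)| |h_x|
         <= c (I sqrt T)^(1/2) I^(1/2) = c T^(1/4) I].
    On the whole line, the integral of [f(h)] is localized by a cutoff of width [N];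
    every Cauchy-Schwarz inequality is used in its AM-GM form, with a parameter
    fixed in advance. *)

Require Import Defs.
From HB Require Import structures.
From mathcomp Require Import all_boot all_order all_algebra.
From mathcomp Require Import all_classical all_reals all_analysis.
From mathcomp Require Import ring lra.
Set Implicit Arguments.
Unset Strict Implicit.
Unset Printing Implicit Defensive.
Import Order.TTheory GRing.Theory Num.Theory.
Import numFieldNormedType.Exports.
Local Open Scope classical_set_scope.
Local Open Scope ring_scope.

(* [g] need not be measurable: the integral of a nonnegative function is a
   supremum over simple functions below it.  This is needed for the metric tensor,
   an infimum over fluxes whose measurability in time is never established. *)
Lemma ge0_le_lower_integral d (T : measurableType d) (R : realType)
    (mu : {measure set T -> \bar R}) (D E : set T) (f g : T -> \bar R) :
  (forall x, E x -> (0 <= g x)%E) -> D `<=` E ->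
  (forall x, D x -> (0 <= f x <= g x)%E) ->
  (\int[mu]_(x in D) f x <= \int[mu]_(x in E) g x)%E.
Proof.
move=> g0 DE fg.
rewrite ge0_integralE; last by move=> x /fg /andP[].
rewrite (ge0_integralE _ g0); apply: le_ereal_sup => _ [k kf <-].
exists k => //= x; apply: le_trans (kf x) _.
rewrite !patchE; case: ifPn => [/set_mem Dx|_].
  by rewrite mem_set; [have /andP[] := fg _ Dx | exact: DE].
by case: ifPn => // /set_mem /g0.
Qed.

(** * Integral calculus for continuous functions on compact intervals *)

Section compact_interval.
Context {R : realType}.
Implicit Types (f g F : R -> R) (a b c x : R).
Local Notation mu := lebesgue_measure.

Lemma continuous_integrable_itv f a b : continuous f ->
  mu.-integrable `[a, b] (EFin \o f).
Proof.
move=> cf; apply: continuous_compact_integrable; first exact: segment_compact.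
exact: continuous_subspaceT.
Qed.

Lemma continuous_le_Rintegral f g a b : continuous f -> continuous g ->
  (forall x, a <= x <= b -> f x <= g x) ->
  \int[mu]_(x in `[a, b]) f x <= \int[mu]_(x in `[a, b]) g x.
Proof.
move=> cf cg fg; apply: le_Rintegral => //; exact: continuous_integrable_itv.
Qed.

Lemma continuous_RintegralD f g a b : continuous f -> continuous g ->
  \int[mu]_(x in `[a, b]) (f x + g x) =
  \int[mu]_(x in `[a, b]) f x + \int[mu]_(x in `[a, b]) g x.
Proof. by move=> cf cg; rewrite RintegralD//; exact: continuous_integrable_itv. Qed.

Lemma continuous_RintegralZl c f a b : continuous f ->
  \int[mu]_(x in `[a, b]) (c * f x) = c * \int[mu]_(x in `[a, b]) f x.
Proof. by move=> cf; rewrite RintegralZl//; exact: continuous_integrable_itv. Qed.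

Lemma EFin_Rintegral_itv f a b : continuous f ->
  (\int[mu]_(x in `[a, b]) f x)%:E = (\int[mu]_(x in `[a, b]) (f x)%:E)%E.
Proof.
move=> cf; rewrite /Rintegral fineK//.
by apply: integrable_fin_num => //; exact: continuous_integrable_itv.
Qed.

Lemma Rintegral_cst_itv c a b : a <= b ->
  \int[mu]_(x in `[a, b]) c = c * (b - a).
Proof.
move=> ab; rewrite Rintegral_cst//= lebesgue_measure_itv/= lte_fin.
case: ltP => [//|ba] /=; have -> : a = b by apply/eqP; rewrite eq_le ab.
by rewrite subrr mulr0.
Qed.

Lemma derivable1_continuous F x : derivable F x 1 -> {for x, continuous F}.
Proof. by move=> dF; apply/differentiable_continuous/derivable1_diffP. Qed.

Lemma is_derive1_continuous F (y x : R) : is_derive x 1 F y -> {for x, continuous F}.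
Proof. by case=> dF _; exact: derivable1_continuous. Qed.

Lemma continuous_in_integrable_itv f a b : {in `[a, b], continuous f} ->
  mu.-integrable `[a, b] (EFin \o f).
Proof.
move=> cf; apply: continuous_compact_integrable; first exact: segment_compact.
by apply: continuous_in_subspaceT => x /set_mem; exact: cf.
Qed.

(** Continuity and differentiability are localized to [[a, b]] because the time derivative of the
    localized entropy is controlled only at interior times of the path. The degenerate case [a = b]
    is split off, since the fundamental theorem of calculus is applied with [a < b]. *)
Lemma Rintegral_derivative_itv F f a b : a <= b -> {in `[a, b], continuous f} ->
  {in `[a, b], forall x : R, is_derive x 1 F (f x)} ->
  \int[mu]_(x in `[a, b]) f x = F b - F a.
Proof.
rewrite le_eqVlt => /predU1P[<- _ _|ab cf dF].
  by rewrite set_itv1 Rintegral_set1 subrr.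
have cF : {in `[a, b], continuous F}.
  by move=> x /dF; exact: is_derive1_continuous.
rewrite /Rintegral (@continuous_FTC2 _ f F)//.
- by apply: continuous_in_subspaceT => x /set_mem; exact: cf.
- split.
  + by move=> x /subset_itv_oo_cc /dF[].
  + by apply: cvg_within_filter; apply: cF; rewrite in_itv/= lexx ltW.
  + by apply: cvg_within_filter; apply: cF; rewrite in_itv/= lexx ltW.
- by move=> x /subset_itv_oo_cc /dF[_ <-]; rewrite derive1E.
Qed.

Lemma Rintegral_derivative F f a b : a <= b -> continuous f ->
  (forall x : R, is_derive x 1 F (f x)) ->
  \int[mu]_(x in `[a, b]) f x = F b - F a.
Proof. by move=> ab cf dF; apply: Rintegral_derivative_itv. Qed.

(** This passes from real integrals over a window to extended-valued integrals over the line, where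
    the right-hand side may be [+oo]. *)
Lemma le_Rintegral_setT f a b : continuous f -> (forall x, 0 <= f x) ->
  ((\int[mu]_(x in `[a, b]) f x)%:E <= \int[mu]_x (f x)%:E)%E.
Proof.
move=> cf f0; rewrite EFin_Rintegral_itv//.
by apply: ge0_le_lower_integral => // x _; rewrite lee_fin ?f0 ?lexx.
Qed.

End compact_interval.

(** * Integrals over a compact interval depending on a parameter *)

Section parametric_integral.
Context {R : realType}.
Implicit Types (F G : R * R -> R) (a b u v t x : R).
Local Notation mu := lebesgue_measure.

Lemma continuous_pair_l G t x : {for (t, x), continuous G} ->
  {for t, continuous (fun s => G (s, x))}.
Proof.
move=> cG; apply: (@continuous_comp _ _ _ (fun s : R => (s, x)) G) => //.
by apply: (@cvg_pair _ _ _ _ (nbhs t) (nbhs x)); [exact: cvg_id|exact: cvg_cst].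
Qed.

Lemma continuous_pair_r G t x : {for (t, x), continuous G} ->
  {for x, continuous (fun y => G (t, y))}.
Proof.
move=> cG; apply: (@continuous_comp _ _ _ (fun y : R => (t, y)) G) => //.
by apply: (@cvg_pair _ _ _ _ (nbhs t) (nbhs x)); [exact: cvg_cst|exact: cvg_id].
Qed.

Lemma rectangle_bounded G u v a b :
  (forall t x, u <= t <= v -> {for (t, x), continuous G}) ->
  exists2 M, 0 <= M & forall t x, u <= t <= v -> a <= x <= b ->
    `|G (t, x)| <= M.
Proof.
move=> cG; have cptK : compact (`[u, v]%classic `*` `[a, b]%classic : set (R * R)).
  by apply: compact_setX; exact: segment_compact.
have /continuous_compact/(_ cptK)/compact_bounded :
    {within `[u, v]%classic `*` `[a, b]%classic, continuous G}.
  apply: continuous_in_subspaceT => -[t x] /set_mem[/= ut _].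
  by apply: cG; move: ut; rewrite in_itv.
move=> [M [_ HM]]; exists (`|M| + 1); first by rewrite addr_ge0.
move=> t x ut ax; apply: (HM (`|M| + 1)).
  by rewrite (le_lt_trans (ler_norm M))// ltrDl.
by exists (t, x) => //; split => /=; rewrite in_itv.
Qed.

Section open_time_interval.
Variables (G : R * R -> R) (u v : R).
Hypothesis cG : forall t x, u < t < v -> {for (t, x), continuous G}.

Lemma parametric_integrable a b t : u < t < v ->
  mu.-integrable `[a, b] (EFin \o (fun x => G (t, x))).
Proof.
by move=> ut; apply: continuous_integrable_itv => x; apply/continuous_pair_r/cG.
Qed.

Lemma cst_integrable_itv a b M : mu.-integrable `[a, b] (EFin \o cst M).
Proof. by apply: (@continuous_integrable_itv _ (cst M)); exact: cst_continuous. Qed.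

(** Continuity on the open strip gives no bound up to [u] and [v], so time is shrunk to an interval
    around [t] whose closure is compact in []u, v[]. The constant [M] is the dominating function in
    the two lemmas below. *)
Lemma local_bound a b t : u < t < v -> exists w z M,
  [/\ u < w, w < t < z, z < v, 0 <= M & forall s x, w < s < z -> a <= x <= b ->
    `|G (s, x)| <= M].
Proof.
move=> /andP[ut tv].
have [M M0 HM] := @rectangle_bounded G ((u + t) / 2) ((t + v) / 2) a b
  ltac:(by move=> s x us; apply: cG; lra).
exists ((u + t) / 2), ((t + v) / 2), M; split => //; try lra.
by move=> s x sw; apply: HM; lra.
Qed.

Lemma parametric_integral_continuous a b t : u < t < v ->
  {for t, continuous (fun s => \int[mu]_(x in `[a, b]) G (s, x))}.
Proof.
move=> ut; have [w [z [M [uw wtz zv M0 HM]]]] := local_bound a b ut.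
apply: (@continuity_under_integral _ _ _ mu (fun s x => G (s, x)) `[a, b]%classic
  _ w z _ _ (cst M)) => //.
- by move=> s /=; rewrite in_itv/= => sw; apply: parametric_integrable; lra.
- apply: aeW => x _ s; rewrite inE/= in_itv/= => sw.
  by apply: continuous_pair_l; apply: cG; lra.
- exact: cst_integrable_itv.
- move=> s /=; rewrite in_itv/= => sw; apply: aeW => x; rewrite in_itv/= => abx.
  exact: HM.
- by rewrite inE/= in_itv.
Qed.

Lemma parametric_integral_is_derive (F : R -> R -> R) a b t :
  (forall t, continuous (F t)) ->
  (forall t x, u < t < v -> is_derive t 1 (F ^~ x) (G (t, x))) ->
  u < t < v ->
  is_derive t 1 (fun s => \int[mu]_(x in `[a, b]) F s x)
    (\int[mu]_(x in `[a, b]) G (t, x)).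
Proof.
move=> cF dF ut; have [w [z [M [uw wtz zv M0 HM]]]] := local_bound a b ut.
have d1 s x : w < s < z -> partial1of2 F s x = G (s, x).
  move=> sw; rewrite partial1of2E.
  by have [_ ->] := dF s x ltac:(lra).
have itw s : (s \in `]w, z[) = (w < s < z) by rewrite in_itv.
have h1 : forall s, `]w, z[%classic s -> mu.-integrable `[a, b] (EFin \o F s).
  by move=> s _; exact: continuous_integrable_itv.
have h2 : forall s x, `]w, z[%classic s -> `[a, b]%classic x -> derivable (F ^~ x) s 1.
  by move=> s x /=; rewrite itw => sw _; have [] := dF s x ltac:(lra).
have h3 : forall s x, `]w, z[%classic s -> `[a, b]%classic x ->
    `|partial1of2 F s x| <= cst M x.
  by move=> s x /=; rewrite itw in_itv/= => sw abx; rewrite d1//; exact: HM.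
have wt : `]w, z[%classic t by rewrite /= itw.
split.
  exact: (@derivable_under_integral _ _ _ mu F `[a, b]%classic _ t w z wt h1 h2
    (cst M) _ (cst_integrable_itv a b M) h3).
rewrite -derive1E (@differentiation_under_integral _ _ _ mu F `[a, b]%classic _ t w z wt h1 h2
    (cst M) _ (cst_integrable_itv a b M) h3)//.
by apply: eq_Rintegral => x _; rewrite d1.
Qed.

End open_time_interval.
End parametric_integral.

(* A density whose first two derivatives are O(1 / sqrt (mobility)): the decay at
   infinity of the first one is what makes the cutoff errors on the whole line
   vanish, and coercivity is what the Dirichlet energy is played against. *)
Record entropy {R : realType} (m C : R) (f f1 f2 : R -> R) : Prop := Entropy {
  entropy_const_gt0 : 0 < C ;
  entropy_derive1 : forall s : R, 0 < s -> is_derive s 1 f (f1 s) ;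
  entropy_derive2 : forall s : R, 0 < s -> is_derive s 1 f1 (f2 s) ;
  entropy_continuous2 : forall s : R, 0 < s -> {for s, continuous f2} ;
  entropy_ge0 : forall s, 0 < s -> 0 <= f s ;
  entropy_at1 : f 1 = 0 ;
  entropy_bound1 : forall s, 0 < s -> f1 s ^+ 2 * mobility m s <= C ;
  entropy_bound2 : forall s, 0 < s -> f2 s ^+ 2 * mobility m s <= C ;
  entropy_coercive : forall s, 0 < s ->
    (s `^ (- (m / 4 - 1)) - 1) ^+ 2 <= C * f s }.

(** * An explicit entropy density *)

Section regularized_power.
Context {R : realType}.
Variables (m : R).
Hypothesis hm : 8 <= m.
Implicit Types (s e : R).
Local Notation k := (m / 2).

Let m0 : 0 < m. Proof. exact: lt_le_trans hm. Qed.
Let k0 : 0 < k. Proof. by rewrite divr_gt0. Qed.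

(* The entropy is [f = (w - 1)^2 v^(-1 - 4/m)] with [w = s^(-m/2)] and [v = 1 + w]:
   it behaves like [s^(2 - m/2)] near 0, and [f'] like [s^(-m/2 - 1)] at infinity.
   Being a combination of powers [v^e] with [e <= 1 - 4/m], it only requires
   bounds on these, which follow from [v^(-4/m) <= min(1, s^2)]. *)
Let w s := s `^ (- k).
Let v s := 1 + w s.
Let pw e s := v s `^ e.
Let dw s := - k * s `^ (- k - 1).
Let dpw e s := e * (v s `^ (e - 1) * dw s).
Let ddw s := - k * ((- k - 1) * s `^ (- k - 1 - 1)).
Let ddpw e s := e * (((e - 1) * v s `^ (e - 1 - 1) * dw s) * dw s + v s `^ (e - 1) * ddw s).

Let v_gt0 s : 0 < v s.
Proof. by rewrite /v ltr_pwDl// powR_ge0. Qed.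

Let v_ge1 s : 1 <= v s.
Proof. by rewrite /v lerDl powR_ge0. Qed.

Let is_derive_w s : 0 < s -> is_derive s 1 w (dw s).
Proof. by move=> s0; exact: is_derive1_powR. Qed.

Let is_derive_pw e s : 0 < s -> is_derive s 1 (pw e) (dpw e s).
Proof.
move=> s0; have dv : is_derive s 1 v (dw s).
  have := is_deriveD (is_derive_cst (1 : R) s 1) (is_derive_w s0).
  by rewrite add0r.
rewrite /dpw mulrA; exact: (is_derive1_comp (is_derive1_powR e (v_gt0 s)) dv).
Qed.

Let is_derive_dw s : 0 < s -> is_derive s 1 dw (ddw s).
Proof. by move=> s0; apply: is_deriveZ; exact: is_derive1_powR. Qed.

Let is_derive_dpw e s : 0 < s -> is_derive s 1 (dpw e) (ddpw e s).
Proof.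
move=> s0; have D := is_deriveZ e (is_deriveM (is_derive_pw (e - 1) s0) (is_derive_dw s0)).
apply: (is_derive_eq D); rewrite /ddpw /dpw /pw /GRing.scale/=; ring.
Qed.

(** As [v >= 1] and [v >= w], the power [v^(-4/m)] is at most [1] and at most [w^(-4/m) = s^2]. *)
Let v_powR_le e s : 0 < s -> e <= 1 - 4 / m ->
  v s `^ (e - 1) <= s /\ v s `^ (e - 1) <= s ^+ 2.
Proof.
move=> s0 em; have h1 : v s `^ (e - 1) <= v s `^ (- (4 / m)).
  by apply: ler_powR => //; lra.
have h4 : 0 <= 4 / m by rewrite divr_ge0// ltW.
have l1 : v s `^ (- (4 / m)) <= 1.
  by rewrite -[leRHS](powRr0 (v s)); apply: ler_powR; rewrite ?oppr_le0.
have l2 : v s `^ (- (4 / m)) <= s ^+ 2.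
  have -> : s ^+ 2 = w s `^ (- (4 / m)).
    rewrite /w -powRrM -(@powR_mulrn _ s 2) ?(ltW s0)//; congr (_ `^ _); field.
    by rewrite gt_eqF.
  rewrite !powRN lef_pV2 ?posrE ?powR_gt0//.
  by apply: ge0_ler_powR => //; rewrite ?nnegrE ?(ltW (v_gt0 _)) ?powR_ge0// /v lerDr.
split; last exact: le_trans h1 l2.
(* The bound by [s] follows from [min(1, s^2) <= s]. *)
have [s1|s1] := leP s 1; last by apply: le_trans h1 (le_trans l1 (ltW s1)).
by apply: le_trans h1 (le_trans l2 _); rewrite expr2 ler_piMl// ltW.
Qed.

Let w_divs s : 0 < s -> s `^ (- k - 1) = w s / s.
Proof.
move=> s0; rewrite powRD; last by rewrite (gt_eqF s0) implybT.
by rewrite powR_inv1// ltW.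
Qed.

Let w_divs2 s : 0 < s -> s `^ (- k - 1 - 1) = w s / s ^+ 2.
Proof.
move=> s0; rewrite powRD; last by rewrite (gt_eqF s0) implybT.
by rewrite w_divs// powR_inv1 ?ltW// -mulrA -invfM.
Qed.

(** Here [dw = - k * w / s], and the factor [1 / s] is absorbed by [v^(e - 1) <= s]. *)
Let dpw_le e s : 0 < s -> e <= 1 - 4 / m -> `|dpw e s| <= (`|e| * k) * w s.
Proof.
move=> s0 em; have [X1 X2] := v_powR_le s0 em.
rewrite /dpw /dw w_divs//; move: (m / 2) k0 => q q0.
rewrite !normrM normrN (gtr0_norm q0).
rewrite (ger0_norm (powR_ge0 _ _)) (ger0_norm (powR_ge0 s _)) normfV (gtr0_norm s0).
rewrite -!mulrA ler_wpM2l ?normr_ge0// mulrCA ler_wpM2l ?(ltW q0)//.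
by rewrite mulrCA ler_piMr ?powR_ge0// ler_pdivrMr// mul1r.
Qed.

(** Both summands carry a factor [1 / s^2], absorbed by [v^(e - 1) <= s^2]; the first one also
    contains [w / v], which is at most 1. *)
Let ddpw_le e s : 0 < s -> e <= 1 - 4 / m ->
  `|ddpw e s| <= (`|e| * (`|e - 1| * k ^+ 2 + k * (k + 1))) * w s.
Proof.
move=> s0 em; have [X1 X2] := v_powR_le s0 em.
have X0 : 0 <= v s `^ (e - 1) by exact: powR_ge0.
have w0 : 0 <= w s by exact: powR_ge0.
rewrite /ddpw normrM -[leRHS]mulrA ler_wpM2l ?normr_ge0//.
rewrite (le_trans (ler_normD _ _))//.
rewrite [leRHS]mulrDl; apply: lerD.
  have -> : v s `^ (e - 1 - 1) = v s `^ (e - 1) / v s.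
    rewrite powRD; last by rewrite (gt_eqF (v_gt0 s)) implybT.
    by rewrite powR_inv1// ltW.
  rewrite /dw w_divs// (_ : _ * _ * _ = (e - 1) * (k ^+ 2 *
    ((v s `^ (e - 1) / s ^+ 2) * (w s / v s) * w s))); last first.
    by field; rewrite !gt_eqF.
  rewrite normrM -[leRHS]mulrA ler_wpM2l// normrM ger0_norm ?sqr_ge0// ler_wpM2l ?sqr_ge0//.
  have A1 : v s `^ (e - 1) / s ^+ 2 <= 1 by rewrite ler_pdivrMr ?exprn_gt0// mul1r.
  have A2 : w s / v s <= 1 by rewrite ler_pdivrMr// mul1r /v lerDr.
  rewrite ger0_norm ?mulr_ge0 ?divr_ge0 ?invr_ge0 ?sqr_ge0 ?(ltW (v_gt0 _))//.
  by rewrite ler_piMl// mulr_ile1 ?mulr_ge0 ?invr_ge0 ?exprn_ge0 ?divr_ge0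
    ?(ltW s0) ?sqr_ge0 ?(ltW (v_gt0 _))//.
rewrite /ddw w_divs2// (_ : _ * _ = k * (k + 1) *
    ((v s `^ (e - 1) / s ^+ 2) * w s)); last by field; rewrite !gt_eqF.
have kk : 0 <= k * (k + 1) by rewrite mulr_ge0 ?addr_ge0 ?(ltW k0).
rewrite normrM (ger0_norm kk) ler_wpM2l//.
rewrite ger0_norm ?mulr_ge0 ?divr_ge0 ?invr_ge0 ?sqr_ge0//.
by rewrite ler_piMl// ler_pdivrMr ?exprn_gt0// mul1r.
Qed.

Let ddpw_continuous e s : 0 < s -> {for s, continuous (ddpw e)}.
Proof.
move=> s0.
have cpw a : {for s, continuous (fun s => v s `^ a)}.
  by apply: differentiable_continuous; apply/derivable1_diffP; have [] := is_derive_pw a s0.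
have cs a : {for s, continuous (fun s => s `^ a)}.
  apply: differentiable_continuous; apply/derivable1_diffP.
  by have [] := is_derive1_powR a s0.
have cdw : {for s, continuous dw} by apply: continuousM; [exact: cst_continuous|exact: cs].
have cddw : {for s, continuous ddw}.
  apply: continuousM; first exact: cst_continuous.
  by apply: continuousM; [exact: cst_continuous|exact: cs].
apply: continuousM; first exact: cst_continuous.
apply: continuousD; last by apply: continuousM.
apply: continuousM => //; apply: continuousM => //; apply: continuousM => //.
exact: cst_continuous.
Qed.

(** The coefficients of [f] come from [(w - 1)^2 = (v - 2)^2 = v^2 - 4 v + 4], multiplied by
    [v^(e0 - 2)]; [e0] is the largest exponent covered by [dpw_le] and [ddpw_le]. *)
Let e0 := 1 - 4 / m.
Let f s := pw e0 s - 4 * pw (e0 - 1) s + 4 * pw (e0 - 2) s.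
Let f1 s := dpw e0 s - 4 * dpw (e0 - 1) s + 4 * dpw (e0 - 2) s.
Let f2 s := ddpw e0 s - 4 * ddpw (e0 - 1) s + 4 * ddpw (e0 - 2) s.

Let fE s : f s = (w s - 1) ^+ 2 * v s `^ (e0 - 2).
Proof.
have vn : v s != 0 by rewrite gt_eqF.
have h1 : v s `^ (e0 - 1) = v s `^ (e0 - 2) * v s.
  rewrite -{3}(@powRr1 _ (v s)) ?(ltW (v_gt0 s))// -powRD ?vn ?implybT//.
  by congr (_ `^ _); ring.
have h0 : v s `^ e0 = v s `^ (e0 - 2) * v s * v s.
  rewrite -h1 -{3}(@powRr1 _ (v s)) ?(ltW (v_gt0 s))// -powRD ?vn ?implybT//.
  by congr (_ `^ _); ring.
by rewrite /f /pw h0 h1 /v; ring.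
Qed.

Let is_derive_comb (g g' : R -> R -> R) s :
  (forall e, is_derive s 1 (g e) (g' e s)) ->
  is_derive s 1 (fun s => g e0 s - 4 * g (e0 - 1) s + 4 * g (e0 - 2) s)
    (g' e0 s - 4 * g' (e0 - 1) s + 4 * g' (e0 - 2) s).
Proof.
move=> dg.
exact: (is_deriveD (is_deriveB (dg e0) (is_deriveZ 4 (dg (e0 - 1))))
  (is_deriveZ 4 (dg (e0 - 2)))).
Qed.

(** Since [mobility m s = w^(-2)], bounds by multiples of [w] cancel it exactly. Being generic in
    [g], this serves both the first and the second derivative. *)
Let comb_bound (g : R -> R -> R) (b : R -> R) s : 0 < s ->
  (forall e, e <= 1 - 4 / m -> `|g e s| <= b e * w s) ->
  (g e0 s - 4 * g (e0 - 1) s + 4 * g (e0 - 2) s) ^+ 2 * mobility m s <=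
  (b e0 + 4 * b (e0 - 1) + 4 * b (e0 - 2)) ^+ 2.
Proof.
move=> s0 hg; have w0 : 0 < w s by exact: powR_gt0.
have -> : mobility m s = (w s ^+ 2)^-1.
  rewrite /mobility /w -powR_mulrn ?powR_ge0// -powRrM -powRN; congr (_ `^ _).
  by field.
rewrite ler_pdivrMr ?exprn_gt0// -exprMn -[leLHS](real_normK (num_real _)).
have H a : a <= e0 -> `|g a s| <= b a * w s by exact: hg.
have h0 := H e0 (lexx _); have h1 := H (e0 - 1) ltac:(lra).
have h2 := H (e0 - 2) ltac:(lra).
rewrite ler_sqr ?nnegrE//.
  rewrite (le_trans (ler_normD _ _))// (le_trans (lerD (ler_normB _ _) (lexx _)))//.
  rewrite !normrM (ger0_norm (_ : 0 <= 4))//; lra.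
have := normr_ge0 (g e0 s); have := normr_ge0 (g (e0 - 1) s).
have := normr_ge0 (g (e0 - 2) s); lra.
Qed.

(** With [th] chosen so that the left-hand power is [w^th], taking square roots leaves
    [|w^th - 1| <= 2 |w - 1| v^(th - 1)]. As [v <= 2 max(1, w)], the factor [2 v^(th - 1)] is at
    least [max(1, w)^(th - 1)]. *)
Let coercive s : 0 < s -> (s `^ (- (m / 4 - 1)) - 1) ^+ 2 <= 4 * f s.
Proof.
move=> s0; set th := 1 / 2 - 2 / m.
have w0 : 0 < w s by exact: powR_gt0.
have v0 := v_gt0 s.
have im : 0 < 2 / m by exact: divr_gt0.
have im4 : 2 / m <= 1 / 4 by rewrite ler_pdivrMr//; have := hm; lra.
have -> : s `^ (- (m / 4 - 1)) = w s `^ th.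
  by rewrite /w -powRrM; congr (_ `^ _); rewrite /th; field; rewrite gt_eqF.
have sqE : v s `^ (e0 - 2) = (v s `^ (th - 1)) ^+ 2.
  rewrite -powR_mulrn ?powR_ge0// -powRrM; congr (_ `^ _).
  by rewrite /th /e0; field; rewrite gt_eqF.
rewrite fE sqE (_ : 4 * _ = (2 * (`|w s - 1| * v s `^ (th - 1))) ^+ 2); last first.
  by rewrite -[in LHS](real_normK (num_real (w s - 1))); ring.
rewrite -[leLHS](real_normK (num_real _)) ler_sqr ?nnegrE ?mulr_ge0 ?powR_ge0//.
have key y : 0 < y -> v s <= 2 * y -> y `^ (th - 1) / 2 <= v s `^ (th - 1).
  move=> y0 vy; have -> : th - 1 = - (1 - th) by lra.
  rewrite !powRN -invfM lef_pV2 ?posrE ?mulr_gt0 ?powR_gt0//.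
  apply: (@le_trans _ _ ((2 * y) `^ (1 - th))).
    by apply: ge0_ler_powR => //; rewrite ?nnegrE ?mulr_ge0 ?(ltW v0) ?(ltW y0)// /th; lra.
  rewrite powRM ?(ltW y0)// mulrC ler_wpM2l ?powR_ge0//.
  by apply: ler1_powR; rewrite /th; lra.
(* For [w <= 1] the claim reduces to [1 - w^th <= 1 - w]. *)
have [w1|w1] := leP (w s) 1.
  have wth1 : w s `^ th <= 1.
    by rewrite -[leRHS](powRr0 (w s)); apply: ger_powR; rewrite ?w0 ?w1// /th; lra.
  have wth : w s <= w s `^ th.
    by apply: ger1_powR; rewrite ?w0 ?w1// /th; lra.
  have /(_ ltr01) := key 1; rewrite powR1 mulr1 => /(_ ltac:(by rewrite /v; lra)) k1.
  rewrite (ler0_norm (_ : w s `^ th - 1 <= 0)) ?subr_le0//.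
  rewrite (ler0_norm (_ : w s - 1 <= 0)) ?subr_le0//; nra.
(* For [w > 1] it reduces to [w^th - 1 <= w^th - w^(th - 1)]. *)
have wth : w s `^ th = w s `^ (th - 1) * w s.
  rewrite -{3}(powRr1 (ltW w0)) -powRD; last by rewrite (gt_eqF w0) implybT.
  by congr (_ `^ _); ring.
have wth2 : w s `^ (th - 1) <= 1.
  by rewrite -[leRHS](powRr0 (w s)); apply: ler_powR; rewrite ?(ltW w1)// /th; lra.
have wth1 : 1 <= w s `^ th.
  by rewrite -[leLHS](powRr0 (w s)); apply: ler_powR; rewrite ?(ltW w1)// /th; lra.
have k1 := key _ w0 ltac:(by rewrite /v; lra).
rewrite (ger0_norm (_ : 0 <= w s `^ th - 1)) ?subr_ge0//.
rewrite (ger0_norm (_ : 0 <= w s - 1)) ?subr_ge0 ?(ltW w1)//.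
move: k1 wth2; rewrite wth; move: (w s `^ (th - 1)) (v s `^ (th - 1)) => X Y; nra.
Qed.

Lemma entropy_exists : exists C f f1 f2, entropy m C f f1 f2.
Proof.
(* [b e] adds the constants of [dpw_le] and [ddpw_le], so that one [K] serves both bounds; the
   weights 1, 4, 4 are the absolute values of the coefficients of [f]. In [K + 4] the 4 is the
   constant of [coercive]. *)
pose b e := `|e| * k + `|e| * (`|e - 1| * k ^+ 2 + k * (k + 1)).
pose K := (b e0 + 4 * b (e0 - 1) + 4 * b (e0 - 2)) ^+ 2.
have K0 : 0 <= K by exact: sqr_ge0.
have kk : 0 <= k * (k + 1) by rewrite mulr_ge0 ?addr_ge0 ?(ltW k0).
exists (K + 4), f, f1, f2; split.
- by rewrite ltr_wpDl.
- by move=> s s0; apply: is_derive_comb => e; exact: is_derive_pw.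
- by move=> s s0; apply: is_derive_comb => e; exact: is_derive_dpw.
- move=> s s0; have c e := @ddpw_continuous e s s0.
  apply: continuousD; last by apply: continuousM; [exact: cst_continuous|exact: c].
  by apply: continuousB => //; apply: continuousM; [exact: cst_continuous|exact: c].
- by move=> s s0; rewrite fE mulr_ge0 ?sqr_ge0 ?powR_ge0.
- by rewrite fE /w powR1 subrr expr0n mul0r.
- move=> s s0; apply: (@le_trans _ _ K); last by rewrite lerDl.
  apply: comb_bound => // e em; rewrite (le_trans (dpw_le s0 em))// ler_wpM2r ?powR_ge0//.
  by rewrite lerDl mulr_ge0// addr_ge0// mulr_ge0// sqr_ge0.
- move=> s s0; apply: (@le_trans _ _ K); last by rewrite lerDl.
  apply: comb_bound => // e em; rewrite (le_trans (ddpw_le s0 em))// ler_wpM2r ?powR_ge0//.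
  by rewrite lerDr mulr_ge0// ltW.
- move=> s s0; rewrite (le_trans (coercive s0))// ler_wpM2r ?lerDr//.
  by rewrite fE mulr_ge0 ?sqr_ge0 ?powR_ge0.
Qed.

End regularized_power.

(** * Entropy production against the metric tensor *)

Section flux_estimate.
Context {R : realType}.
Variables (m C : R) (f f1 f2 : R -> R).
Hypothesis ent : entropy m C f f1 f2.
Local Notation mu := lebesgue_measure.
Implicit Types x : R.

(** A parabola vanishing at [-N] and [N], which removes boundary terms, and with slope at most
    [2 / N] in absolute value between them. It is negative outside this window, hence integrated
    over the window only. *)
Definition cutoff (N x : R) : R := 1 - (x / N) ^+ 2.

Lemma is_derive_cutoff (N x : R) : is_derive x 1 (cutoff N) (- (2 * x / N ^+ 2)).
Proof.
have D : is_derive x 1 (fun y : R => y / N) (N^-1).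
  have := @is_deriveZ _ _ _ (id : R -> R) N^-1 x 1 1 (is_derive_id x 1).
  rewrite /GRing.scale/= mulr1 (_ : _ \*: _ = (fun y : R => y / N))//.
  by apply/funext => y /=; rewrite mulrC.
have E := is_deriveB (is_derive_cst (1 : R) x 1) (is_deriveM D D).
apply: (is_derive_eq E); rewrite /GRing.scale/= sub0r expr2 invfM; ring.
Qed.

Lemma cutoff_continuous N : continuous (cutoff N).
Proof. by move=> x; exact: is_derive1_continuous (is_derive_cutoff N x). Qed.

Lemma cutoff_itv N x : 0 < N -> - N <= x <= N -> 0 <= cutoff N x <= 1.
Proof.
move=> N0 /andP[x1 x2]; rewrite /cutoff lerBlDr lerDl sqr_ge0 andbT subr_ge0.
rewrite -[leLHS](real_normK (num_real _)) expr_le1 ?normr_ge0//.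
by rewrite ler_norml ler_pdivrMr// ler_pdivlMr// mulN1r mul1r x1 x2.
Qed.

Variables (u du v : R -> R) (N D lam : R).
Hypothesis u0 : forall x, 0 < u x.
Hypothesis duP : forall x : R, is_derive x 1 u (du x).
Hypothesis cdu : continuous du.
Hypothesis cv : continuous v.
Hypothesis N0 : 0 < N.
Hypothesis lam0 : 0 < lam.
Hypothesis energy_le : (\int[mu]_x ((du x) ^+ 2)%:E <= D%:E)%E.

Let cu : continuous u.
Proof. by move=> x; exact: is_derive1_continuous (duP x). Qed.

Let cf1u : continuous (fun x => f1 (u x)).
Proof.
move=> x; apply: (continuous_comp (@cu x)).
exact: is_derive1_continuous (entropy_derive2 ent (u0 x)).
Qed.

Let cf2u : continuous (fun x => f2 (u x)).
Proof.
by move=> x; apply: (continuous_comp (@cu x)); exact: (entropy_continuous2 ent).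
Qed.

Let cM : continuous (fun x => mobility m (u x)).
Proof.
move=> x; apply: (continuous_comp (@cu x)).
exact: is_derive1_continuous (is_derive1_powR m (u0 x)).
Qed.

Let M0 x : 0 < mobility m (u x).
Proof. exact: powR_gt0. Qed.

(** The derivative of [cutoff N x * f1 (u x)], which multiplies the flux after integration by
    parts. *)
Let P (x : R) : R := - (2 * x / N ^+ 2) * f1 (u x) + cutoff N x * (f2 (u x) * du x).

Let cdeta : continuous (fun x : R => - (2 * x / N ^+ 2)).
Proof.
rewrite (_ : (fun x => _) = (fun x => - (2 / N ^+ 2) * x)).
  exact: mulrl_continuous.
by apply/funext => x; ring.
Qed.

Let cP : continuous P.
Proof.
move=> x; exact: (continuousD (continuousM (@cdeta x) (@cf1u x))
  (continuousM (@cutoff_continuous N x) (continuousM (@cf2u x) (@cdu x)))).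
Qed.

Let P_le x : - N <= x <= N ->
  P x ^+ 2 * mobility m (u x) <= 2 * C * (4 / N ^+ 2 + du x ^+ 2).
Proof.
move=> xN; have b1 := entropy_bound1 ent (u0 x).
have b2 := entropy_bound2 ent (u0 x); have C0 := entropy_const_gt0 ent.
have /andP[e0 e1] := cutoff_itv N0 xN.
have d1 : (- (2 * x / N ^+ 2)) ^+ 2 <= 4 / N ^+ 2.
  rewrite sqrrN (_ : _ ^+ 2 = 4 / N ^+ 2 * (x / N) ^+ 2); last first.
    by field; rewrite gt_eqF.
  rewrite ler_piMr ?divr_ge0 ?sqr_ge0//.
  by move: e0; rewrite /cutoff subr_ge0.
have e2 : cutoff N x ^+ 2 <= 1 by rewrite expr_le1.
have := M0 x; move: (mobility m (u x)) b1 b2 => M b1 b2 hM.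
rewrite /P; move: (f1 (u x)) (f2 (u x)) (- (2 * x / N ^+ 2)) (cutoff N x) (du x)
  (4 / N ^+ 2) b1 b2 d1 e2 => p q r s t a b1 b2 d1 e2.
have A1 : (r * p) ^+ 2 * M <= a * C.
  rewrite exprMn -mulrA; apply: ler_pM => //; rewrite ?sqr_ge0//.
  by rewrite mulr_ge0 ?sqr_ge0 ?(ltW hM).
have A2 : (s * (q * t)) ^+ 2 * M <= C * t ^+ 2.
  rewrite exprMn -mulrA -[leRHS]mul1r; apply: ler_pM => //; rewrite ?sqr_ge0//.
    by rewrite mulr_ge0 ?sqr_ge0 ?(ltW hM).
  by rewrite exprMn mulrAC ler_wpM2r ?sqr_ge0.
(* The square of the difference yields [(y + z)^2 <= 2 y^2 + 2 z^2] for the two summands of [P]. *)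
have := mulr_ge0 (sqr_ge0 (r * p - s * (q * t))) (ltW hM); nra.
Qed.

(** As [j' = - v], integration by parts moves the derivative onto [cutoff * f1(u)], and AM-GM with
    parameter [lam] separates [j] from [P]. The term [8 / N] is the integral of [4 / N^2] over the
    window. *)
Lemma flux_pairing (j : R -> R) :
  (forall x, derivable j x 1 /\ derive1 j x + v x = 0) ->
  ((\int[mu]_(x in `[- N, N]) (cutoff N x * f1 (u x) * v x))%R%:E <=
  (lam / 2)%:E * \int[mu]_x ((j x) ^+ 2 / mobility m (u x))%:E +
   (2 * C * (8 / N + D) / (2 * lam))%:E)%E.
Proof.
move=> dj; have dj' (x : R) : is_derive x 1 j (- v x).
  have [dx /eqP] := dj x; rewrite addr_eq0 => /eqP jx.
  by split => //; rewrite -derive1E.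
have cj : continuous j by move=> x; exact: is_derive1_continuous (dj' x).
pose B (x : R) : R := cutoff N x * f1 (u x) * v x.
have cB : continuous B.
  by move=> x; exact: (continuousM (continuousM (@cutoff_continuous N x) (@cf1u x)) (@cv x)).
pose Q (x : R) : R := P x * j x.
have cQ : continuous Q by move=> x; exact: (continuousM (@cP x) (@cj x)).
have dF (x : R) : is_derive x 1 (fun x => cutoff N x * f1 (u x) * j x) (Q x + (-1) * B x).
  have Du := is_derive1_comp (entropy_derive2 ent (u0 x)) (duP x).
  apply: (is_derive_eq (is_deriveM (is_deriveM (is_derive_cutoff N x) Du) (dj' x))).
  rewrite /GRing.scale/= (_ : (cutoff N * (f1 \o u)) x = cutoff N x * f1 (u x))//.
  by rewrite /Q /P /B; ring.
have NN : - N <= N by move: N0; lra.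
have cB' : continuous (fun x => -1 * B x).
  by move=> x; exact: (continuousM (@cst_continuous _ _ (-1 : R) x) (@cB x)).
(* [Q - B] is the derivative of [cutoff * f1(u) * j], which vanishes at both ends. *)
have BQ : \int[mu]_(x in `[- N, N]) B x = \int[mu]_(x in `[- N, N]) Q x.
  have := Rintegral_derivative NN _ dF.
  have c0 s : s = 1 \/ s = -1 -> cutoff N (s * N) = 0.
    by rewrite /cutoff mulfK ?gt_eqF// => -[]->; rewrite ?sqrrN expr1n subrr.
  have := c0 1 (or_introl erefl); have := c0 (-1) (or_intror erefl).
  rewrite mulN1r mul1r => -> ->; rewrite !mul0r subrr.
  rewrite continuous_RintegralD// continuous_RintegralZl// mulN1r => /(_ _)/eqP.
  rewrite subr_eq0 => /(_ _)/eqP <- //.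
  by move=> x; exact: (continuousD (@cQ x) (@cB' x)).
pose J (x : R) : R := (j x) ^+ 2 / mobility m (u x).
have cJ : continuous J.
  have Mn (x : R) : mobility m (u x) != 0 by rewrite gt_eqF.
  have cMi : continuous (fun x => (mobility m (u x))^-1).
    by move=> x; apply: cvgV; [exact: Mn|exact: cM].
  have cj2 : continuous (fun x => j x ^+ 2) by move=> x; exact: (continuousM (@cj x) (@cj x)).
  by move=> x; exact: (continuousM (@cj2 x) (@cMi x)).
have J0 x : 0 <= J x by rewrite divr_ge0 ?sqr_ge0// ltW.
have cdu2 : continuous (fun x => du x ^+ 2).
  by move=> x; exact: (continuousM (@cdu x) (@cdu x)).
have c4 : continuous (fun x => 4 / N ^+ 2 + du x ^+ 2).
  by move=> x; exact: (continuousD (@cst_continuous _ _ (4 / N ^+ 2) x) (@cdu2 x)).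
pose k := 2 * C / (2 * lam).
have k0 : 0 <= k.
  by rewrite divr_ge0 ?mulr_ge0 ?(ltW lam0)// ltW// (entropy_const_gt0 ent).
have ckd : continuous (fun x => k * (4 / N ^+ 2 + du x ^+ 2)).
  by move=> x; exact: (continuousM (@cst_continuous _ _ k x) (@c4 x)).
have clJ : continuous (fun x => lam / 2 * J x).
  by move=> x; exact: (continuousM (@cst_continuous _ _ (lam / 2) x) (@cJ x)).
have QJ : \int[mu]_(x in `[- N, N]) Q x <= \int[mu]_(x in `[- N, N])
    (lam / 2 * J x + k * (4 / N ^+ 2 + du x ^+ 2)).
  apply: continuous_le_Rintegral => //.
    by move=> x; exact: (continuousD (@clJ x) (@ckd x)).
  move=> x xN; apply: (@le_trans _ _
    (lam / 2 * J x + (P x ^+ 2 * mobility m (u x)) / (2 * lam))).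
    (* AM-GM: [P j <= lam j^2 / (2 M) + M P^2 / (2 lam)] *)
    rewrite /Q /J -subr_ge0; move: (mobility m (u x)) (M0 x) => M hM.
    rewrite (_ : _ - _ = (lam * j x - M * P x) ^+ 2 / (2 * lam * M)).
      by rewrite divr_ge0 ?sqr_ge0// !mulr_ge0// ltW.
    by field; rewrite !gt_eqF.
  rewrite lerD2l /k [leRHS]mulrAC ler_wpM2r ?invr_ge0 ?mulr_ge0 ?(ltW lam0)//.
  exact: P_le.
rewrite continuous_RintegralD// !continuous_RintegralZl// in QJ.
rewrite continuous_RintegralD// in QJ; last by move=> x; exact: cst_continuous.
rewrite Rintegral_cst_itv// in QJ.
have duD : \int[mu]_(x in `[- N, N]) du x ^+ 2 <= D.
  rewrite -lee_fin; apply: le_trans energy_le.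
  by apply: le_Rintegral_setT => // x; exact: sqr_ge0.
have JJ : ((lam / 2)%:E * (\int[mu]_(x in `[- N, N]) J x)%:E <=
    (lam / 2)%:E * \int[mu]_x (J x)%:E)%E.
  by apply: lee_wpmul2l; [rewrite lee_fin divr_ge0// ltW|exact: le_Rintegral_setT].
apply: le_trans (leeD2r _ JJ); rewrite -EFinM -EFinD lee_fin -/B BQ.
apply: le_trans QJ _; rewrite lerD2l /k.
rewrite [leRHS](_ : _ = 2 * C / (2 * lam) * (8 / N + D)); last by ring.
rewrite ler_wpM2l//= lerD// [leLHS](_ : _ = 8 / N)//.
by field; rewrite gt_eqF.
Qed.

(** Solving [flux_pairing] for the action gives a lower bound free of [j], which therefore passes to
    the infimum. *)
Lemma flux_metric_tensor :
  ((2 / lam * (\int[mu]_(x in `[- N, N]) (cutoff N x * f1 (u x) * v x)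
     - 2 * C * (8 / N + D) / (2 * lam)))%:E <=
   metric_tensor (mobility m) u v)%E.
Proof.
apply: le_ereal_inf_tmp => _ [j dj <-].
have := flux_pairing dj; set J := (integral _ _ _); set B := Rintegral _ _ _.
set K := _ / _ => BJ.
have : (0 <= J)%E.
  by apply: integral_ge0 => x _; rewrite lee_fin divr_ge0 ?sqr_ge0// powR_ge0.
(* An infinite action makes the bound trivial; nonnegativity excludes [-oo]. *)
case: J BJ => [r|_ _|]//; last by rewrite leey.
rewrite -EFinM -EFinD !lee_fin => BJ r0.
rewrite [leRHS](_ : _ = 2 / lam * (lam / 2 * r)); last by field; rewrite gt_eqF.
by rewrite ler_wpM2l ?divr_ge0 ?(ltW lam0)// lerBlDr.
Qed.

End flux_estimate.

(** * Continuity within a set, then energy bounds and regularity along a film path *)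

Lemma within_comp_continuous (U V W : topologicalType) (A : set V) (F : V -> W)
    (g : U -> V) :
  {within A, continuous F} -> continuous g -> (forall p, A (g p)) ->
  continuous (F \o g).
Proof.
move=> /subspace_continuousP cF cg Ag p S /= FS.
have : nbhs p (fun q => A (g q) -> S (F (g q))) by exact: (cg p _ (cF _ (Ag p) S FS)).
by apply: filterS => q; exact.
Qed.

Lemma within_nbhs_continuous (V W : topologicalType) (A : set V) (F : V -> W) p :
  nbhs p A -> {within A, continuous F} -> {for p, continuous F}.
Proof.
move=> pA /subspace_continuousP cF S FS; 
have AS : nbhs p (fun q => A q -> S (F q)) by exact: (cF _ (nbhs_singleton pA) S FS).
by apply: filterS2 pA AS => q Aq; exact.
Qed.

Section film.
Context {R : realType}.
Implicit Types t x : R.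
Local Notation mu := lebesgue_measure.

Lemma metric_tensor_ge0 (M : R -> R) (u v : R -> R) :
  (forall x, 0 <= M (u x)) -> (0 <= metric_tensor M u v)%E.
Proof.
move=> M0; apply: le_ereal_inf_tmp => _ [j _ <-]; apply: integral_ge0 => x _.
by rewrite lee_fin divr_ge0 ?sqr_ge0.
Qed.

Lemma mobility_metric_tensor_ge0 (m : R) (u v : R -> R) :
  (0 <= metric_tensor (mobility m) u v)%E.
Proof. by apply: metric_tensor_ge0 => x; exact: powR_ge0. Qed.

Lemma dirichlet_energy_ge0 (u : R -> R) : (0 <= dirichlet_energy u)%E.
Proof.
rewrite /dirichlet_energy mule_ge0 ?lee_fin ?invr_ge0//.
by apply: integral_ge0 => x _; rewrite lee_fin sqr_ge0.
Qed.

Lemma dirichlet_energy_cst (c : R) : dirichlet_energy (cst c) = 0%E.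
Proof.
rewrite /dirichlet_energy integral0_eq ?mule0// => x _.
by rewrite derive1_cst expr0n.
Qed.

Variables (m T I : R) (h : R -> R -> R).
Hypothesis path : film_path (mobility m) T h.
Hypothesis T0 : 0 < T.
Hypothesis h01 : forall x, h 0 x = 1.
Hypothesis rate_le : (rate_functional (mobility m) h T <= I%:E)%E.

Let half0 : (0 <= (2^-1)%:E :> \bar R)%E.
Proof. by rewrite lee_fin invr_ge0. Qed.

(** The unexpanded form has a nonnegative integrand and so grows with the final time; the expanded
    form, with its energy difference, does not show this. *)
Let rate_mono t : t <= T ->
  (rate_functional (mobility m) h t <= rate_functional (mobility m) h T)%E.
Proof.
move=> tT; apply: lee_wpmul2l => //; apply: ge0_le_lower_integral.
- by move=> s _; exact: mobility_metric_tensor_ge0.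
- by apply: subset_itvl; rewrite bnd_simp.
- by move=> s _; rewrite mobility_metric_tensor_ge0/=.
Qed.

(** With zero initial energy, the expanded form on [[0, t]] is a sum of three nonnegative terms,
    each at most the total. *)
Let action_energy_le t : 0 < t <= T ->
  ((2^-1)%:E * \int[mu]_(s in `]0%R, t[)
     metric_tensor (mobility m) (h s) (time_derivative h s) <= I%:E)%E /\
  (dirichlet_energy (h t) <= I%:E)%E.
Proof.
move=> t0T; have /andP[_ tT] := t0T.
have := le_trans (rate_mono tT) rate_le.
rewrite (film_rate_functionalE path t0T) /rate_functional_expanded.
have -> : h 0 = cst 1 by apply/funext => x; rewrite h01.
rewrite dirichlet_energy_cst oppe0 adde0.
have le3 (a b c : \bar R) : (0 <= a)%E -> (0 <= b)%E -> (0 <= c)%E ->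
    (a + b + c <= I%:E)%E -> (a <= I%:E)%E /\ (c <= I%:E)%E.
  move=> a0 b0 c0 abc; split; apply: le_trans abc.
    by rewrite -addeA leeDl// adde_ge0.
  by rewrite leeDr// adde_ge0.
apply: le3; last exact: dirichlet_energy_ge0.
- apply: mule_ge0 => //; apply: integral_ge0 => s _.
  exact: mobility_metric_tensor_ge0.
- apply: mule_ge0 => //; apply: integral_ge0 => s _.
  exact: mobility_metric_tensor_ge0.
Qed.

Lemma film_action_le : (\int[mu]_(s in `]0%R, T[)
  metric_tensor (mobility m) (h s) (time_derivative h s) <= (2 * I)%:E)%E.
Proof.
have [+ _] := @action_energy_le T ltac:(by rewrite T0 lexx).
by rewrite lee_pdivrMl// -EFinM.
Qed.

Lemma film_energy_le t : 0 < t <= T ->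
  (\int[mu]_x ((derive1 (h t) x) ^+ 2)%:E <= (2 * I)%:E)%E.
Proof. by move=> /action_energy_le[_]; rewrite /dirichlet_energy lee_pdivrMl// -EFinM. Qed.

Lemma film_derive_space t x : 0 <= t <= T -> is_derive x 1 (h t) (derive1 (h t) x).
Proof.
move=> tT; have /= d := film_derivable_space path (isT : (0 < 4)%N) tT.
by apply: DeriveDef; [exact: d|rewrite derive1E].
Qed.

Lemma film_continuous_derive1 t : 0 <= t <= T -> continuous (derive1 (h t)).
Proof.
move=> tT x; apply: derivable1_continuous.
exact: (film_derivable_space path (isT : (1 < 4)%N) tT).
Qed.

(* Freezing the path outside [0, T] makes it continuous on the whole plane. *)
Definition clamp t := Num.max 0 (Num.min t T).

Lemma clamp_itv t : 0 <= clamp t <= T.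
Proof. by rewrite /clamp le_max lexx/= ge_max (ltW T0) ge_min lexx orbT. Qed.

Lemma clamp_id t : 0 <= t <= T -> clamp t = t.
Proof. by move=> /andP[t0 tT]; rewrite /clamp min_l// max_r. Qed.

Lemma clamp_continuous : continuous clamp.
Proof.
move=> t; apply: (@continuous_max _ _ (cst 0) (fun t => Num.min t T)).
  exact: cst_continuous.
apply: (@continuous_min _ _ id (cst T)); first exact: cvg_id.
exact: cst_continuous.
Qed.

Lemma film_continuous : continuous (fun p : R * R => h (clamp p.1) p.2).
Proof.
have /= ch := film_continuous_space path (isT : (0 <= 4)%N).
apply: (@within_comp_continuous _ _ _ _ (fun p => h p.1 p.2)
  (fun p : R * R => (clamp p.1, p.2)) ch).
  move=> p; apply: (@cvg_pair _ _ _ _ (nbhs (clamp p.1)) (nbhs p.2)).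
    by apply: (continuous_comp _ (@clamp_continuous _)); exact: cvg_fst.
  exact: cvg_snd.
by move=> p; split => //=; rewrite in_itv/= clamp_itv.
Qed.

Lemma film_continuous_time_derivative t x : 0 < t < T ->
  {for (t, x), continuous (fun p : R * R => time_derivative h p.1 p.2)}.
Proof.
move=> tT; apply: within_nbhs_continuous (film_continuous_time path).
exists (`]0, T[%classic, setT); last by move=> [a b].
split => /=; last exact: filterT.
by apply: near_in_itvoo; rewrite in_itv.
Qed.

End film.

(** * Growth in time of the localized entropy *)

Section density_growth.
Context {R : realType}.
Implicit Types t x : R.
Local Notation mu := lebesgue_measure.

Variables (m T I : R) (h : R -> R -> R).
Hypothesis path : film_path (mobility m) T h.
Hypothesis T0 : 0 < T.
Hypothesis h01 : forall x, h 0 x = 1.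
Hypothesis rate_le : (rate_functional (mobility m) h T <= I%:E)%E.

Variables (C : R) (f f1 f2 : R -> R).
Hypothesis ent : entropy m C f f1 f2.
Variables (N lam : R).
Hypothesis N0 : 0 < N.
Hypothesis lam0 : 0 < lam.

(** [A] is the localized entropy, clamped in time so as to be continuous on all of [R], and [B] is
    its derivative at interior times. [K / (2 * lam)] is the error term of [flux_pairing] under the
    energy bound [D = 2 * I]. *)
Let A t := \int[mu]_(x in `[- N, N]) (cutoff N x * f (h (clamp T t) x)).
Let B t := \int[mu]_(x in `[- N, N])
  (cutoff N x * f1 (h t x) * time_derivative h t x).
Let K := 2 * C * (8 / N + 2 * I).

Let hpos t x : 0 <= t <= T -> 0 < h t x.
Proof. exact: (film_pos path). Qed.

Let cA t x : {for (t, x), continuous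
  (fun p : R * R => cutoff N p.2 * f (h (clamp T p.1) p.2))}.
Proof.
have c1 : {for (t, x), continuous (fun p : R * R => cutoff N p.2)}.
  apply: (@continuous_comp _ _ _ (fun p : R * R => p.2) (cutoff N)).
    exact: cvg_snd.
  exact: (@cutoff_continuous _ N x).
have c2 : {for (t, x), continuous (fun p : R * R => f (h (clamp T p.1) p.2))}.
  apply: (@continuous_comp _ _ _ (fun p : R * R => h (clamp T p.1) p.2) f).
    exact: (film_continuous path T0).
  apply: is_derive1_continuous; apply: (entropy_derive1 ent).
  by apply: hpos; exact: clamp_itv.
exact: (continuousM c1 c2).
Qed.

Let near_clamp t : 0 < t < T -> \forall s \near t, clamp T s = s.
Proof.
move=> tT; have : \forall s \near t, s \in `]0, T[.
  by apply: near_in_itvoo; rewrite in_itv.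
apply: filterS => s; rewrite in_itv/= => /andP[s0 sT].
by apply: clamp_id; rewrite !ltW.
Qed.

Let cB t x : 0 < t < T -> {for (t, x), continuous
  (fun p : R * R => cutoff N p.2 * f1 (h p.1 p.2) * time_derivative h p.1 p.2)}.
Proof.
move=> tT; have tT' : 0 <= t <= T by case/andP: tT => *; rewrite !ltW.
have c1 : {for (t, x), continuous (fun p : R * R => cutoff N p.2)}.
  apply: (@continuous_comp _ _ _ (fun p : R * R => p.2) (cutoff N)).
    exact: cvg_snd.
  exact: (@cutoff_continuous _ N x).
have c2 : {for (t, x), continuous (fun p : R * R => f1 (h (clamp T p.1) p.2))}.
  apply: (@continuous_comp _ _ _ (fun p : R * R => h (clamp T p.1) p.2) f1).
    exact: (film_continuous path T0).
  apply: is_derive1_continuous; apply: (entropy_derive2 ent).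
  by apply: hpos; exact: clamp_itv.
(* Joint continuity is known for the clamped path, which agrees with [h] near an interior time. *)
have c3 : {for (t, x), continuous (fun p : R * R => f1 (h p.1 p.2))}.
  have e : {near (t, x), (fun p : R * R => f1 (h (clamp T p.1) p.2)) =1
      (fun p : R * R => f1 (h p.1 p.2))}.
    have : \forall p \near (t, x), clamp T p.1 = p.1.
      by apply: (@cvg_fst _ _ (nbhs t) (nbhs x) _ _ (near_clamp tT)).
    by apply: filterS => p /= ->.
  rewrite /prop_for /continuous_at; apply: cvg_trans (near_eq_cvg e) _.
  by have := c2; rewrite /prop_for /continuous_at/= clamp_id.
have c4 : {for (t, x), continuous (fun p : R * R => time_derivative h p.1 p.2)}.
  exact: (film_continuous_time_derivative (x := x) path tT).
exact: (continuousM (continuousM c1 c3) c4).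
Qed.

Let A_continuous : continuous A.
Proof.
move=> t; apply: (@parametric_integral_continuous _
  (fun p => cutoff N p.2 * f (h (clamp T p.1) p.2)) (t - 1) (t + 1)); last by lra.
by move=> s x _; exact: cA.
Qed.

Let B_continuous t : 0 < t < T -> {for t, continuous B}.
Proof.
move=> tT; apply: (@parametric_integral_continuous _
  (fun p => cutoff N p.2 * f1 (h p.1 p.2) * time_derivative h p.1 p.2) 0 T) => //.
Qed.

Let is_derive_A t : 0 < t < T -> is_derive t 1 A (B t).
Proof.
move=> tT; pose G (p : R * R) : R :=
  cutoff N p.2 * f1 (h p.1 p.2) * time_derivative h p.1 p.2.
pose F (t x : R) : R := cutoff N x * f (h (clamp T t) x).
have cF s : continuous (F s) by move=> x; exact: (continuous_pair_r (@cA s x)).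
have dF s x : 0 < s < T -> is_derive s 1 (F ^~ x) (G (s, x)).
  move=> sT; have d1 : is_derive s 1 (fun r => h r x) (time_derivative h s x).
    by apply: DeriveDef; [exact: (film_derivable_time path)|
      rewrite /time_derivative derive1E].
  have hs : 0 < h s x by apply: hpos; case/andP: sT => *; rewrite !ltW.
  have d2 := is_deriveZ (cutoff N x) (is_derive1_comp (entropy_derive1 ent hs) d1).
  have e : {near s, (fun r => cutoff N x * f (h r x)) =1 (F ^~ x)}.
    by have := near_clamp sT; apply: filterS => r; rewrite /F => ->.
  have [d3 d4] := d2; split.
    exact: near_eq_derivable e d3.
  have := near_eq_derive (f := fun r => cutoff N x * f (h r x)) (g := F ^~ x) (a := s) 1 e.
  by move=> <-; rewrite d4 /GRing.scale/= mulrA.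
have D := @parametric_integral_is_derive R G 0 T cB F (- N) N t cF dF tT. exact D.
Qed.

Let excess_le t : 0 < t < T ->
  ((2 / lam * (B t - K / (2 * lam)))%:E <=
   metric_tensor (mobility m) (h t) (time_derivative h t))%E.
Proof.
move=> tT; have tT' : 0 <= t <= T by case/andP: tT => *; rewrite !ltW.
apply: (flux_metric_tensor ent (du := derive1 (h t))) => //.
- by move=> x; exact: hpos.
- by move=> x; apply: (film_derive_space path).
- exact: (film_continuous_derive1 path).
- by move=> x; exact: (continuous_pair_r (film_continuous_time_derivative (x := x) path tT)).
- by apply: (film_energy_le path) => //; case/andP: tT => -> /ltW ->.
Qed.

(** The bound [B <= lam / 2 * b + K / (2 * lam)] is integrated over [[t1, t2]], where [b] lies below
    the metric tensor and so has integral at most [2 * I]. *)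
Let increment_le t1 t2 : 0 < t1 -> t1 <= t2 -> t2 < T ->
  A t2 - A t1 <= lam * I + K / (2 * lam) * (t2 - t1).
Proof.
move=> t10 t12 t2T.
have inT t : t \in `[t1, t2] -> 0 < t < T by rewrite in_itv/=; lra.
have cBi : {in `[t1, t2], continuous B} by move=> t /inT; exact: B_continuous.
rewrite -(Rintegral_derivative_itv t12 cBi); last by move=> t /inT; exact: is_derive_A.
(* [b] is a continuous minorant of the metric tensor. *)
pose b t := Num.max 0 (2 / lam * (B t - K / (2 * lam))).
have cb : {in `[t1, t2], continuous b}.
  move=> t tI; apply: (@continuous_max _ _ (cst 0)
    (fun t => 2 / lam * (B t - K / (2 * lam)))).
    exact: cst_continuous.
  exact: (continuousM (@cst_continuous _ _ (2 / lam) t)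
    (continuousB (cBi _ tI) (@cst_continuous _ _ (K / (2 * lam)) t))).
have ib := continuous_in_integrable_itv cb.
have cbI : \int[mu]_(t in `[t1, t2]) b t <= 2 * I.
  rewrite -lee_fin /Rintegral fineK; last exact: integrable_fin_num.
  apply: le_trans (film_action_le path T0 h01 rate_le).
  apply: ge0_le_lower_integral.
  - by move=> s _; exact: mobility_metric_tensor_ge0.
  - by move=> t /inT; rewrite /= in_itv.
  - move=> t /inT tT; rewrite lee_fin /b le_max lexx/= EFin_max ge_max.
    by rewrite mobility_metric_tensor_ge0 excess_le.
have clb : {in `[t1, t2], continuous (fun t => lam / 2 * b t)}.
  move=> t tI.
  exact: (continuousM (@cst_continuous _ _ (lam / 2) t) (cb _ tI)).
have -> : lam * I + K / (2 * lam) * (t2 - t1) =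
    lam / 2 * (2 * I) + K / (2 * lam) * (t2 - t1) by congr (_ + _); field.
have cc : mu.-integrable `[t1, t2] (EFin \o cst (K / (2 * lam))).
  by apply: continuous_in_integrable_itv => t _; exact: cst_continuous.
apply: (@le_trans _ _ (\int[mu]_(t in `[t1, t2]) (lam / 2 * b t + K / (2 * lam)))).
  apply: le_Rintegral => //.
  - exact: continuous_in_integrable_itv.
  - apply: continuous_in_integrable_itv => t tI.
    exact: (continuousD (clb _ tI) (@cst_continuous _ _ (K / (2 * lam)) t)).
  - move=> t _; rewrite -lerBlDr -ler_pdivrMl ?divr_gt0//.
    by rewrite invf_div /b le_max lexx orbT.
rewrite RintegralD//; last exact: continuous_in_integrable_itv.
rewrite RintegralZl// Rintegral_cst_itv// lerD2r ler_wpM2l//.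
by rewrite divr_ge0// ltW.
Qed.

(** [increment_le] concerns interior times only; continuity of [A] carries it to the endpoints, and
    [A 0 = 0] because the entropy vanishes at 1. *)
Lemma film_density_increment : 0 <= I ->
  \int[mu]_(x in `[- N, N]) (cutoff N x * f (h T x)) <=
  lam * I + K / (2 * lam) * T.
Proof.
move=> I0; have AT : A T = \int[mu]_(x in `[- N, N]) (cutoff N x * f (h T x)).
  by apply: eq_Rintegral => x _; rewrite clamp_id// lexx ltW.
have A0 : A 0 = 0.
  rewrite /A (_ : (fun x => _) = cst 0) ?Rintegral_cst ?mul0r//.
  by apply/funext => x; rewrite clamp_id ?lexx ?ltW// h01 (entropy_at1 ent) mulr0.
have kl0 : 0 <= K / (2 * lam).
  rewrite divr_ge0 ?mulr_ge0 ?(ltW lam0) ?addr_ge0 ?mulr_ge0 ?invr_ge0 ?(ltW N0)//.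
  exact/ltW/(entropy_const_gt0 ent).
rewrite -AT leNgt; apply/negP => cA'.
(* [e] is half the supposed excess of [A T] over the bound [c]: approximating both endpoint values
   within [e] still leaves [A t2 - A t1 > c]. *)
set c := _ + _ in cA'; pose e := (A T - c) / 2.
have e0 : 0 < e by rewrite divr_gt0// subr_gt0.
have nT : \forall t \near T^'-, `|A T - A t| < e.
  by apply: cvgr_dist_lt => //; exact/cvg_at_left_filter/A_continuous.
have n0 : \forall t \near 0^'+, `|A 0 - A t| < e.
  by apply: cvgr_dist_lt => //; exact/cvg_at_right_filter/A_continuous.
near T^'- => t2; near (0:R)^'+ => t1.
have h1 : `|A 0 - A t1| < e by near: t1.
have h2 : `|A T - A t2| < e by near: t2.
have t10 : 0 < t1 by near: t1; exact: nbhs_right_gt.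
have t2T : t2 < T by near: t2; exact: nbhs_left_lt.
have t1T : t1 < T / 2 by near: t1; apply: nbhs_right_lt; rewrite divr_gt0.
have t2T2 : T / 2 < t2 by near: t2; apply: nbhs_left_gt; rewrite ltr_pdivrMr// ltr_pMr// ltr1n.
have inc := increment_le t10 (ltW (lt_trans t1T t2T2)) t2T.
have : K / (2 * lam) * (t2 - t1) <= K / (2 * lam) * T by rewrite ler_wpM2l//; lra.
move: h1 h2 inc e0; rewrite A0 /e /c !ltr_norml => /andP[h1 _] /andP[_ h2] inc e0 h3.
move: h1 h2 inc e0 h3; lra.
Unshelve. all: by end_near. Qed.

End density_growth.

(** * Interpolation between the entropy and the Dirichlet energy *)

Section interpolation.
Context {R : realType}.
Implicit Types x y s : R.
Local Notation mu := lebesgue_measure.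

(** The difference is minus the integral of [psi1(g) g'], and [- p q <= k p^2 / 2 + q^2 / (2 k)]
    because [(k p + q)^2 >= 0]. *)
Lemma interpolation_le (psi psi1 g dg : R -> R) (k a b : R) : 0 < k -> a <= b ->
  (forall s : R, 0 < s -> is_derive s 1 psi (psi1 s)) ->
  (forall s, 0 < s -> {for s, continuous psi1}) ->
  (forall x, 0 < g x) -> (forall x, is_derive x 1 g (dg x)) -> continuous dg ->
  psi (g a) - psi (g b) <=
  k / 2 * (\int[mu]_(x in `[a, b]) psi1 (g x) ^+ 2)
  + (2 * k)^-1 * \int[mu]_(x in `[a, b]) dg x ^+ 2.
Proof.
move=> k0 ab dpsi cpsi1 g0 dgP cdg.
have cg : continuous g by move=> x; exact: is_derive1_continuous (dgP x).
have cp : continuous (fun x => psi1 (g x)).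
  by move=> x; apply: (continuous_comp (@cg x)); exact: cpsi1.
have cq : continuous (fun x => psi1 (g x) * dg x).
  by move=> x; exact: (continuousM (@cp x) (@cdg x)).
have dF x : is_derive x 1 (psi \o g) (psi1 (g x) * dg x).
  exact (is_derive1_comp (dpsi _ (g0 x)) (dgP x)).
have cp2 : continuous (fun x => psi1 (g x) ^+ 2).
  by move=> x; exact: (continuousM (@cp x) (@cp x)).
have cd2 : continuous (fun x => dg x ^+ 2).
  by move=> x; exact: (continuousM (@cdg x) (@cdg x)).
have ck1 : continuous (fun x => k / 2 * psi1 (g x) ^+ 2).
  by move=> x; exact: (continuousM (@cst_continuous _ _ (k / 2) x) (@cp2 x)).
have ck2 : continuous (fun x => (2 * k)^-1 * dg x ^+ 2).
  by move=> x; exact: (continuousM (@cst_continuous _ _ (2 * k)^-1 x) (@cd2 x)).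
have cN : continuous (fun x => -1 * (psi1 (g x) * dg x)).
  by move=> x; exact: (continuousM (@cst_continuous _ _ (-1 : R) x) (@cq x)).
rewrite -opprB -mulN1r -(Rintegral_derivative ab cq dF) -continuous_RintegralZl//.
rewrite -!continuous_RintegralZl// -continuous_RintegralD//.
apply: continuous_le_Rintegral => //.
  by move=> x; exact: (continuousD (@ck1 x) (@ck2 x)).
move=> x _; rewrite -subr_ge0 (_ : _ - _ = (k * psi1 (g x) + dg x) ^+ 2 / (2 * k)).
  by rewrite divr_ge0 ?sqr_ge0// mulr_ge0// ltW.
by field; rewrite gt_eqF.
Qed.

End interpolation.

(** * The pointwise bound at the final time *)

Section film_bound.
Context {R : realType}.
Implicit Types x y s : R.
Local Notation mu := lebesgue_measure.
Variables (m T I : R) (h : R -> R -> R).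
Hypothesis hm : 8 <= m.
Hypothesis path : film_path (mobility m) T h.
Hypothesis T0 : 0 < T.
Hypothesis h01 : forall x, h 0 x = 1.
Hypothesis I0 : 0 < I.
Hypothesis rate_le : (rate_functional (mobility m) h T <= I%:E)%E.
Variables (C : R) (f f1 f2 : R -> R).
Hypothesis ent : entropy m C f f1 f2.
Let q := T `^ (1 / 4).

Let q0 : 0 < q. Proof. exact: powR_gt0. Qed.

Let q4 : q ^+ 2 * q ^+ 2 = T.
Proof.
rewrite -exprD -powR_mulrn ?powR_ge0// -powRrM (_ : 1 / 4 * 4%:R = 1) ?powRr1 ?(ltW T0)//.
by field.
Qed.

Let TT : 0 <= T <= T. Proof. by rewrite lexx ltW. Qed.

Let gpos x : 0 < h T x. Proof. exact: (film_pos path). Qed.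

Let cfg : continuous (fun x => f (h T x)).
Proof.
move=> x; apply: (@continuous_comp _ _ _ (h T) f).
  exact: is_derive1_continuous (film_derive_space path x TT).
exact: is_derive1_continuous (entropy_derive1 ent (gpos x)).
Qed.

(** Twice the bound of [film_density_increment] with [lam = q^2], the square root of [T], and with
    [8 / N] replaced by [I]. This [lam] makes both of its terms multiples of [I * q^2]. *)
Let S := 2 * (1 + 3 * C) * I * q ^+ 2.

Lemma film_density_local a b : a <= b -> \int[mu]_(x in `[a, b]) f (h T x) <= S.
Proof.
(* The summand [8 / I] ensures [8 / N <= I]; the other puts [[a, b]] inside [[-N/2, N/2]], where the
   cutoff is at least [3/4], so that twice the cutoff exceeds 1. *)
move=> ab; pose N := 8 / I + 2 * (`|a| + `|b|).
have N8 : 0 < 8 / I by rewrite divr_gt0.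
have N0 : 0 < N by rewrite ltr_pwDl// mulr_ge0// addr_ge0.
have IN : 8 / N <= I.
  rewrite ler_pdivrMr// mulrC -ler_pdivrMr// /N lerDl mulr_ge0// addr_ge0//.
have abN x : x \in `[a, b] -> - N / 2 <= x <= N / 2.
  rewrite in_itv/= => /andP[ax xb]; have := ler_norm b; have := ler_norm (- a).
  by rewrite normrN /N; have := normr_ge0 a; have := normr_ge0 b; move: N8; lra.
have lam0 : 0 < q ^+ 2 by rewrite exprn_gt0.
have := film_density_increment path T0 h01 rate_le ent N0 lam0 (ltW I0).
set J := Rintegral _ _ _ => HJ.
have C0 := entropy_const_gt0 ent.
have JS : 2 * J <= S.
  rewrite /S -[leRHS](_ :
    2 * (q ^+ 2 * I + 2 * C * (3 * I) / (2 * q ^+ 2) * T) = _); last first.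
    by rewrite -q4; field; rewrite gt_eqF.
  rewrite ler_wpM2l//; apply: le_trans HJ _; rewrite lerD2l.
  have i0 : 0 <= (2 * q ^+ 2)^-1 by rewrite invr_ge0 mulr_ge0// ltW.
  apply: ler_wpM2r; first exact: ltW.
  apply: (ler_wpM2r i0).
  by rewrite ler_wpM2l ?mulr_ge0 ?(ltW C0)//; move: IN; lra.
apply: le_trans JS.
have cJ : continuous (fun x => cutoff N x * f (h T x)).
  by move=> x; exact: (continuousM (@cutoff_continuous _ N x) (@cfg x)).
have c2J : continuous (fun x => 2 * (cutoff N x * f (h T x))).
  by move=> x; exact: (continuousM (@cst_continuous _ _ (2 : R) x) (@cJ x)).
rewrite -continuous_RintegralZl// -lee_fin !EFin_Rintegral_itv//.
apply: ge0_le_lower_integral.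
- move=> x; rewrite /= in_itv/= => xN; have /andP[e0 _] := cutoff_itv N0 xN.
  by rewrite lee_fin !mulr_ge0// (entropy_ge0 ent).
- by move=> x /abN; rewrite /= in_itv/=; move: N0; lra.
- move=> x /abN xN; rewrite !lee_fin (entropy_ge0 ent)//= mulrA ler_peMl//.
    exact: (entropy_ge0 ent).
  have : (x / N) ^+ 2 <= (1 / 2) ^+ 2.
    rewrite -[leLHS](real_normK (num_real _)) ler_sqr ?nnegrE// ler_norml.
    by rewrite ler_pdivrMr// ler_pdivlMr//; lra.
  rewrite /cutoff; lra.
Qed.

Variables (psi psi1 : R -> R) (D : R).
Hypothesis D0 : 0 <= D.
Hypothesis dpsi : forall s, 0 < s -> is_derive s 1 psi (psi1 s).
Hypothesis cpsi1 : forall s, 0 < s -> {for s, continuous psi1}.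
Hypothesis psi1_le : forall s, 0 < s ->
  psi1 s ^+ 2 <= D * (s `^ (- (m / 4 - 1)) - 1) ^+ 2.
Hypothesis psi_at1 : psi 1 = 0.

(** By coercivity, a small [f s] forces [z = s^(-r)] close to 1, and [psi s = psi (z^(-1/r))] is
    continuous in [z] with value 0 at [z = 1]. *)
Let psi_small (e : R) : 0 < e -> exists2 d, 0 < d &
  forall s, 0 < s -> f s <= d -> psi s <= e.
Proof.
move=> e0; pose r := m / 4 - 1; have r0 : 0 < r by rewrite /r; have := hm; lra.
have C0 := entropy_const_gt0 ent.
have c1 : {for (1 : R), continuous (fun z => psi (z `^ (- r^-1)))}.
  apply: (@continuous_comp _ _ _ (fun z => z `^ (- r^-1)) psi).
    exact: is_derive1_continuous (is_derive1_powR _ ltr01).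
  by rewrite powR1; exact: is_derive1_continuous (dpsi ltr01).
have /cvgrPdist_le/(_ _ e0) := c1; rewrite powR1 psi_at1.
move=> /nbhs_ballP[d /= d0 Hd].
exists ((d / 2) ^+ 2 / C); first by rewrite divr_gt0// exprn_gt0// divr_gt0.
move=> s s0 fs; have := Hd (s `^ (- r)).
rewrite /ball/= -powRrM mulrNN mulfV ?gt_eqF// powRr1 ?(ltW s0)// sub0r normrN.
move=> H; apply: le_trans (ler_norm _) (H _).
rewrite distrC; apply: (@le_lt_trans _ _ (d / 2)); last first.
  by rewrite ltr_pdivrMr// ltr_pMr// ltr1n.
rewrite -ler_sqr ?nnegrE ?(ltW d0) ?divr_ge0 ?(ltW d0)//.
rewrite (real_normK (num_real _)); apply: le_trans (entropy_coercive ent s0) _.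
by rewrite mulrC -ler_pdivlMr.
Qed.

(** In place of a limit at infinity, a point [y] at which the entropy density is small serves as the
    far end of the interpolation; there [psi] is at most [e], which is arbitrary. *)
Lemma film_bound x : psi (h T x) <= (D * C * (1 + 3 * C) + 1) * (q * I).
Proof.
apply/ler_addgt0Pr => e e0; have [d d0 dP] := psi_small e0.
have C0 := entropy_const_gt0 ent.
have S0 : 0 <= S.
  have c13 : 0 <= 1 + 3 * C by rewrite addr_ge0// mulr_ge0// ltW.
  apply: mulr_ge0; last exact: sqr_ge0.
  by apply: mulr_ge0; [exact: mulr_ge0|exact: ltW].
(* If the density exceeded [d] on all of [[x, x + L]], its integral would be at least
   [d * L = S + d > S]. *)
pose L := S / d + 1.
have L0 : 0 < L by rewrite ltr_wpDl// divr_ge0// ltW.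
have [y /andP[xy yL] fy] : exists2 y, x <= y <= x + L & f (h T y) <= d.
  apply: contrapT => H; have xL : x <= x + L by rewrite lerDl ltW.
  have := film_density_local xL; apply/negP; rewrite -ltNge.
  apply: (@lt_le_trans _ _ (d * L)).
    by rewrite /L mulrDr mulr1 mulrCA mulfV ?gt_eqF// mulr1 ltrDl.
  have := @continuous_le_Rintegral _ (cst d) (fun x => f (h T x)) x (x + L).
  rewrite Rintegral_cst_itv// (addrC x) addrK; apply => //.
    by move=> z; exact: cst_continuous.
  move=> z zxL; rewrite leNgt; apply/negP => fz; apply: H.
  by exists z; [rewrite (addrC x)|exact: ltW].
(* With the parameter [q^-1], both terms of the interpolation become multiples of [q * I], as [S] is
   proportional to [q^2 * I]. *)
have q'0 : 0 < q^-1 by rewrite invr_gt0.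
have cd := film_continuous_derive1 path TT.
have := interpolation_le q'0 xy dpsi cpsi1 gpos (fun z => film_derive_space path z TT) cd.
set P := Rintegral _ _ _; set E := Rintegral _ _ _.
have PS : P <= D * C * S.
  apply: (@le_trans _ _ (\int[mu]_(z in `[x, y]) (D * C * f (h T z)))).
    apply: continuous_le_Rintegral.
    - have cp z : {for z, continuous (fun z => psi1 (h T z))}.
        apply: (@continuous_comp _ _ _ (h T) psi1); last exact: cpsi1.
        exact: is_derive1_continuous (film_derive_space path z TT).
      by move=> z; exact: (continuousM (@cp z) (@cp z)).
    - by move=> z; exact: (continuousM (@cst_continuous _ _ (D * C) z) (@cfg z)).
    - move=> z _; apply: le_trans (psi1_le (gpos z)) _.
      by rewrite -mulrA ler_wpM2l// (entropy_coercive ent).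
  rewrite continuous_RintegralZl// ler_wpM2l ?mulr_ge0 ?(ltW C0)//.
  exact: film_density_local.
have E2 : E <= 2 * I.
  rewrite -lee_fin; apply: le_trans (film_energy_le path h01 rate_le (t := T) _); last first.
    by rewrite T0 lexx.
  apply: le_Rintegral_setT => [z|z]; last exact: sqr_ge0.
  exact: (continuousM (@cd z) (@cd z)).
move=> H; have := dP _ (gpos y) fy.
have B1 : q^-1 / 2 * P <= D * C * (1 + 3 * C) * (q * I).
  apply: le_trans (ler_wpM2l _ PS) _; first by rewrite divr_ge0// ltW.
  by rewrite /S le_eqVlt; apply/orP; left; apply/eqP; field; rewrite gt_eqF.
have B2 : (2 * q^-1)^-1 * E <= q * I.
  apply: le_trans (ler_wpM2l _ E2) _; first by rewrite invr_ge0 mulr_ge0// ltW.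
  by rewrite le_eqVlt; apply/orP; left; apply/eqP; field; rewrite gt_eqF.
move: H B1 B2; lra.
Qed.

End film_bound.

(** * From a barrier function to bounds on the rate functional *)

Section rate_bound.
Context {R : realType}.
Implicit Types s : R.

Lemma rate_functional_ge0 (m T : R) (h : R -> R -> R) :
  (0 <= rate_functional (mobility m) h T)%E.
Proof.
rewrite /rate_functional mule_ge0 ?lee_fin ?invr_ge0//.
by apply: integral_ge0 => t _; exact: mobility_metric_tensor_ge0.
Qed.

(** The bound on [psi1] is the condition [|psi'| <= c sqrt f] with [f] replaced by its coercive
    lower bound, so barriers can be checked without the entropy. The entropy is fixed before the
    path, so [c] does not depend on [T] or [h]. *)
Lemma rate_functional_lower_bound (m D : R) (psi psi1 : R -> R) :
  8 <= m -> 0 <= D ->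
  (forall s, 0 < s -> is_derive s 1 psi (psi1 s)) ->
  (forall s, 0 < s -> {for s, continuous psi1}) ->
  (forall s, 0 < s -> psi1 s ^+ 2 <= D * (s `^ (- (m / 4 - 1)) - 1) ^+ 2) ->
  psi 1 = 0 ->
  exists2 c : R, 0 < c & forall (T : R) (h : R -> R -> R), 0 < T ->
    film_path (mobility m) T h -> (forall x : R, h 0 x = 1) -> forall x,
    ((c * psi (h T x))%:E <=
     (T `^ (1 / 4))%:E * rate_functional (mobility m) h T)%E.
Proof.
move=> hm D0 dpsi cpsi1 psi1_le psi_at1.
have [C [f [f1 [f2 ent]]]] := entropy_exists hm.
have C0 := entropy_const_gt0 ent.
pose k := D * C * (1 + 3 * C) + 1.
have k0 : 0 < k by rewrite ltr_wpDl// !mulr_ge0 ?addr_ge0 ?mulr_ge0 ?(ltW C0).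
exists k^-1; first by rewrite invr_gt0.
move=> T h T0 path h01 x; have q0 : 0 < T `^ (1 / 4) by exact: powR_gt0.
have := rate_functional_ge0 m T h.
case E : (rate_functional (mobility m) h T) => [r| |]// r0; last first.
  by rewrite gt0_muley ?lte_fin// leey.
rewrite -EFinM lee_fin mulrC ler_pdivrMr// mulrC.
(* [film_bound] asks for [I > 0] while [r] may be 0; the added term contributes exactly [e] after
   multiplication by [k * T^(1/4)]. *)
apply/ler_addgt0Pr => e e0; pose I := r + e / (k * T `^ (1 / 4)).
have I0 : 0 < I by rewrite ltr_wpDl// divr_gt0// mulr_gt0.
have rI : (rate_functional (mobility m) h T <= I%:E)%E.
  by rewrite E lee_fin lerDl divr_ge0 ?mulr_ge0 ?(ltW e0) ?(ltW k0) ?(ltW q0).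
have := film_bound hm path T0 h01 I0 rI ent D0 dpsi cpsi1 psi1_le psi_at1 x.
rewrite -/k /I mulrDr mulrDr [X in _ <= _ + X -> _](_ : _ = e)//.
by field; rewrite !gt_eqF.
Qed.

Lemma mule_ereal_sup_le (c : R) (X : \bar R) (g : R -> R) : 0 < c ->
  (forall x, ((c * g x)%:E <= X)%E) ->
  (c%:E * ereal_sup (range (fun x => (g x)%:E)) <= X)%E.
Proof.
move=> c0 H; rewrite -lee_pdivlMl//; apply: ge_ereal_sup => _ [x _ <-].
by rewrite lee_pdivlMl// -EFinM.
Qed.

Lemma rate_functional_diverges (m c : R) (psi : R -> R) : 0 < c ->
  (forall (T : R) (h : R -> R -> R), 0 < T ->
    film_path (mobility m) T h -> (forall x : R, h 0 x = 1) -> forall x,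
    ((c * psi (h T x))%:E <=
     (T `^ (1 / 4))%:E * rate_functional (mobility m) h T)%E) ->
  (forall K : R, exists2 d : R, 0 < d & forall s, 0 < s < d -> K <= psi s) ->
  forall K : R, exists2 delta : R, 0 < delta &
    forall (T : R) (h : R -> R -> R), 0 < T ->
      film_path (mobility m) T h -> (forall x : R, h 0 x = 1) ->
      inf (range (h T)) < delta ->
      ((K / T `^ (1 / 4))%R%:E <= rate_functional (mobility m) h T)%E.
Proof.
move=> c0 H psi_large K; have [d d0 Hd] := psi_large (K / c).
exists d => // T h T0 path h01 hinf.
have q0 : 0 < T `^ (1 / 4) by exact: powR_gt0.
(* Otherwise [d] would be a lower bound of the range of [h T], hence at most its infimum. *)
have [x hx] : exists x, h T x < d.
  apply: contrapT => nx; move: hinf; apply/negP; rewrite -leNgt.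
  apply: lb_le_inf; first by exists (h T 0); exists 0.
  by move=> _ [x _ <-]; rewrite leNgt; apply/negP => hx; apply: nx; exists x.
have hx0 : 0 < h T x by apply: (film_pos path); rewrite lexx ltW.
rewrite mulrC EFinM lee_pdivrMl//; apply: le_trans (H _ _ T0 path h01 x).
by rewrite lee_fin -ler_pdivrMl// mulrC Hd// hx0.
Qed.

End rate_bound.

(** * The barrier for [m = 8] *)

Section log_barrier.
Context {R : realType}.
Implicit Types s : R.

(** The primitive of [1 - 1/s] that vanishes at 1; for [m = 8] the comparison function
    [s^(-(m/4 - 1)) - 1] is [1/s - 1]. *)
Definition log_barrier s := ln (1 / s) - 1 + s.

Lemma log_barrierE s : 0 < s -> log_barrier s = - ln s - 1 + s.
Proof. by move=> s0; rewrite /log_barrier div1r lnV. Qed.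

Lemma is_derive_log_barrier s : 0 < s -> is_derive s 1 log_barrier (1 - s^-1).
Proof.
move=> s0; have D := is_deriveD (is_deriveB (is_deriveN (is_derive1_ln s0))
  (is_derive_cst (1 : R) s 1)) (is_derive_id s (1 : R)).
(* The formula with [- ln s] is established for positive arguments only, so the derivative is
   transferred by equality near [s]. *)
have e : {near s, (fun s => - ln s - 1 + s) =1 log_barrier}.
  near=> t; have t0 : 0 < t by near: t; exact: lt_nbhsr.
  by rewrite log_barrierE.
have [d1 d2] := D; split; first exact: near_eq_derivable e d1.
have := near_eq_derive (f := fun s => - ln s - 1 + s) (g := log_barrier) (a := s) 1 e.
by move=> <-; rewrite d2 subr0 addrC.
Unshelve. all: by end_near. Qed.

Lemma log_barrier_large (K : R) :
  exists2 d : R, 0 < d & forall s, 0 < s < d -> K <= log_barrier s.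
Proof.
(* Below this threshold [- ln s >= K + 1], so the barrier is at least [K + s]. *)
exists (expR (- (K + 1))); first exact: expR_gt0.
move=> s /andP[s0 sd]; rewrite log_barrierE//.
have : ln s <= - (K + 1) by rewrite -[leRHS]expRK ler_ln ?posrE ?expR_gt0// ltW.
by lra.
Qed.

End log_barrier.

(** * The barrier for [m > 8], with [a = m/8 - 1] *)

Section power_barrier.
Context {R : realType}.
Implicit Types s : R.
Variable a : R.
Hypothesis a0 : 0 < a.

(** Squaring the whole difference, not its positive part, gives a smooth function of [s > 0] that
    dominates the squared positive part. *)
Definition power_barrier s := (s `^ (- a) - 1) ^+ 2.
Let d s : R := 2 * ((s `^ (- a) - 1) * (- a * s `^ (- a - 1))).

Lemma is_derive_power_barrier s : 0 < s -> is_derive s 1 power_barrier (d s).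
Proof.
move=> s0; have D := is_deriveB (is_derive1_powR (- a) s0) (is_derive_cst (1 : R) s 1).
apply: (is_derive_eq (is_deriveM D D)); rewrite /GRing.scale/= subr0 /d.
by rewrite (_ : (_ - cst 1) s = s `^ (- a) - 1)//; ring.
Qed.

Lemma power_barrier_derive_continuous s : 0 < s -> {for s, continuous d}.
Proof.
move=> s0; have cs b : {for s, continuous (fun t => t `^ b)}.
  exact: is_derive1_continuous (is_derive1_powR b s0).
have c1 : {for s, continuous (fun t => t `^ (- a) - 1)}.
  exact: (continuousB (cs _) (@cst_continuous _ _ (1 : R) s)).
have c2 : {for s, continuous (fun t => - a * t `^ (- a - 1))}.
  exact: (continuousM (@cst_continuous _ _ (- a) s) (cs _)).
exact: (continuousM (@cst_continuous _ _ (2 : R) s) (continuousM c1 c2)).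
Qed.

(** With [p = s^(-a)] and [z = 1/s], the claim compares [(p - 1) p z] with [p^2 z - 1]. They differ
    by [p z - 1], and all three quantities are nonnegative for [s <= 1] and nonpositive for
    [s > 1]. *)
Lemma power_barrier_derive_le s : 0 < s ->
  d s ^+ 2 <= (2 * a) ^+ 2 * (s `^ (- (2 * a + 1)) - 1) ^+ 2.
Proof.
move=> s0; have sn : s != 0 by rewrite gt_eqF.
have z0 : 0 < s^-1 by rewrite invr_gt0.
have p0 : 0 < s `^ (- a) by exact: powR_gt0.
have e1 : s `^ (- a - 1) = s `^ (- a) * s^-1.
  by rewrite powRD ?sn ?implybT// powR_inv1// ltW.
have e2 : s `^ (- (2 * a + 1)) = s `^ (- a) * s `^ (- a) * s^-1.
  rewrite -mulrA -e1 -powRD ?sn ?implybT//; congr (_ `^ _); ring.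
rewrite /d e1 e2.
have -> : 2 * ((s `^ (- a) - 1) * (- a * (s `^ (- a) * s^-1))) =
  (2 * a) * - ((s `^ (- a) - 1) * (s `^ (- a) * s^-1)) by ring.
rewrite exprMn ler_wpM2l ?sqr_ge0// sqrrN.
have [s1|s1] := leP s 1.
  have z1 : 1 <= s^-1 by rewrite invf_ge1.
  have p1 : 1 <= s `^ (- a).
    by rewrite -[leLHS](powRr0 s); apply: ger_powR; rewrite ?s0// oppr_le0 ltW.
  move: (s^-1) (s `^ (- a)) z0 p0 z1 p1 => z p z0 p0 z1 p1.
  have pz : 1 <= p * z by rewrite -[1]mulr1 ler_pM.
  rewrite ler_sqr ?nnegrE.
  - by rewrite mulrBl mul1r mulrA lerD2l lerN2.
  - by rewrite mulr_ge0 ?subr_ge0// ltW// mulr_gt0.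
  - by rewrite subr_ge0 -mulrA -[1]mulr1 ler_pM.
have z1 : s^-1 <= 1 by rewrite invf_le1// ltW.
have p1 : s `^ (- a) <= 1.
  by rewrite -[leRHS](powRr0 s); apply: ler_powR; rewrite ?(ltW s1)// oppr_le0 ltW.
move: (s^-1) (s `^ (- a)) z0 p0 z1 p1 => z p z0 p0 z1 p1.
have pz : p * z <= 1 by rewrite mulr_ile1 ?(ltW p0) ?(ltW z0).
have pz0 : 0 <= p * z by rewrite mulr_ge0 ?(ltW p0) ?(ltW z0).
rewrite -[leLHS]sqrrN -[leRHS]sqrrN -mulNr !opprB ler_sqr ?nnegrE.
- by rewrite mulrBl mul1r mulrA lerD2r.
- by rewrite mulr_ge0 ?subr_ge0.
- by rewrite subr_ge0 -mulrA mulr_ile1// ltW.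
Qed.

Lemma power_barrier_large (K : R) :
  exists2 e : R, 0 < e & forall s, 0 < s < e -> K <= power_barrier s.
Proof.
(* Once [s^(-a) >= 2 + |K|], the barrier is at least [(1 + |K|)^2 >= K]. *)
pose L := 2 + `|K|; have L0 : 0 < L by rewrite ltr_pwDl.
exists (L `^ (- a^-1)); first exact: powR_gt0.
move=> s /andP[s0 sL].
have : L <= s `^ (- a).
  have -> : L = (L `^ (- a^-1)) `^ (- a).
    by rewrite -powRrM mulrNN mulVf ?gt_eqF// powRr1// ltW.
  rewrite !(powRN _ a) lef_pV2 ?posrE ?powR_gt0//.
  by apply: ge0_ler_powR; rewrite ?nnegrE ?powR_ge0 ?ltW.
rewrite /power_barrier /L; move: (s `^ (- a)) => p; have := ler_norm K.
have := normr_ge0 K; nra.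
Qed.

End power_barrier.

(** Both conclusions follow from one pointwise bound on a barrier at [h T x]: the first by taking
    the supremum over [x], the second because the barrier is unbounded near 0. *)
Theorem proposition10p2 (R : realType) (m : R) (hm : 8 <= m) :
  (exists2 c : R, 0 < c &
    forall (T : R) (h : R -> R -> R), 0 < T ->
      film_path (mobility m) T h -> (forall x : R, h 0 x = 1) ->
      (c%:E *
         (if m == 8%R then
            ereal_sup (range (fun x : R =>
              (positive_part (ln (1 / h T x) - 1 + h T x)%R)%:E))
          else
            ereal_sup (range (fun x : R =>
              ((positive_part (1 / (h T x `^ (m / 8 - 1)) - 1)) ^+ 2)%R%:E)))
       <= (T `^ (1 / 4))%R%:E * rate_functional (mobility m) h T)%E) /\
  (forall K : R, exists2 delta : R, 0 < delta &
    forall (T : R) (h : R -> R -> R), 0 < T ->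
      film_path (mobility m) T h -> (forall x : R, h 0 x = 1) ->
      inf (range (h T)) < delta ->
      ((K / T `^ (1 / 4))%R%:E <= rate_functional (mobility m) h T)%E).
Proof.
have rhs0 T h : (0 <= (T `^ (1 / 4))%R%:E * rate_functional (mobility m) h T)%E.
  by rewrite mule_ge0 ?lee_fin ?powR_ge0// rate_functional_ge0.
case: eqVneq => [m8|m8].
  have [c c0 H] : exists2 c : R, 0 < c & forall (T : R) (h : R -> R -> R), 0 < T ->
      film_path (mobility m) T h -> (forall x : R, h 0 x = 1) -> forall x,
      ((c * log_barrier (h T x))%:E <=
       (T `^ (1 / 4))%:E * rate_functional (mobility m) h T)%E.
    apply: (@rate_functional_lower_bound _ m 1 _ (fun s => 1 - s^-1)) => //.
    - by move=> s; exact: is_derive_log_barrier.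
    - move=> s s0; have ci : {for s, continuous (fun t : R => t^-1)}.
        by apply: inv_continuous; rewrite gt_eqF.
      exact: (continuousB (@cst_continuous _ _ (1 : R) s) ci).
    - move=> s s0; rewrite m8 (_ : 8 / 4 - 1 = 1); last by field.
      by rewrite powR_inv1 ?(ltW s0)// mul1r -sqrrN opprB.
    - by rewrite /log_barrier divr1 ln1 sub0r addNr.
  split; last exact: rate_functional_diverges c0 H log_barrier_large.
  exists c => // T h T0 path h01; apply: mule_ereal_sup_le => // x.
  (* The positive part is a maximum with 0, and 0 is below the right-hand side by [rhs0]. *)
  rewrite /positive_part maxr_pMr ?(ltW c0)// mulr0 EFin_max ge_max rhs0 andbT.
  exact: H.
pose a := m / 8 - 1.
have a0 : 0 < a by rewrite /a subr_gt0 ltr_pdivlMr// mul1r lt_neqAle eq_sym m8.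
have [c c0 H] : exists2 c : R, 0 < c & forall (T : R) (h : R -> R -> R), 0 < T ->
    film_path (mobility m) T h -> (forall x : R, h 0 x = 1) -> forall x,
    ((c * power_barrier a (h T x))%:E <=
     (T `^ (1 / 4))%:E * rate_functional (mobility m) h T)%E.
  apply: (@rate_functional_lower_bound _ m ((2 * a) ^+ 2) _
    (fun s => 2 * ((s `^ (- a) - 1) * (- a * s `^ (- a - 1))))) => //.
  - exact: sqr_ge0.
  - by move=> s; exact: is_derive_power_barrier.
  - by move=> s; exact: power_barrier_derive_continuous.
  (* With [a = m/8 - 1], the exponent [2 a + 1] of [power_barrier_derive_le] is exactly the
     coercivity exponent. *)
  - move=> s s0; have -> : m / 4 - 1 = 2 * a + 1 by rewrite /a; field.
    exact: power_barrier_derive_le.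
  - by rewrite /power_barrier powR1 subrr expr0n.
split; last exact: rate_functional_diverges c0 H (power_barrier_large a0).
exists c => // T h T0 path h01; apply: mule_ereal_sup_le => // x.
apply: le_trans (H _ _ T0 path h01 x); rewrite lee_fin ler_wpM2l ?(ltW c0)//.
rewrite /positive_part /power_barrier powRN div1r -/a.
have [_|_] := leP ((h T x `^ a)^-1 - 1) 0; last exact: lexx.
by rewrite expr0n sqr_ge0.
Qed.
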